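(* Assume (A1), (A2), (A3) of the context. Then, choosing step sizes $\eta_k=\eta k^{-a}$ with $1/2<a<1$ and a sufficiently small constant $\eta>0$, the iterates $z_k$ of the Stochastic Extra-Gradient method described in the context and their averages $\bar z_k=\frac1k\sum_{i=1}^k z_i$ satisfy $$z_k\to z^*\quad\text{almost surely}\qquad\text{and}\qquad \bar z_k\to z^*\quad\text{almost surely, as }k\to\infty.$$
   Context: Setting. Let $d=d_\theta+d_\mu$, $z=(\theta,\mu)\in\mathbb R^{d_\theta}\times\mathbb R^{d_\mu}=\mathbb R^d$, and let $f(\theta,\mu)=\mathbb E[F(\theta,\mu,w)]$, where $w\in\mathbb R^d$ is a random data sample and the expectation is with respect to $w$. Let $z^*=(\theta^*,\mu^* )$ be the saddle point of $f$, i.e. the solution of $\min_\theta\max_\mu f(\theta,\mu)$. Put $H(z)=(\nabla_\theta f(z)^\top,-\nabla_\mu f(z)^\top)^\top$, and let $H(z,w)$ denote the noisy evaluation of $H(z)$ with data sample $w$. The noise is $\xi(z,w)=H(z)-H(z,w)$. Let $$Q^*=\begin{bmatrix}\nabla^2_{\theta\theta}f(z^* )&\nabla^2_{\mu\theta}f(z^* )\\-\nabla^2_{\theta\mu}f(z^* )&-\nabla^2_{\mu\mu}f(z^* )\end{bmatrix}.$$ Algorithm (Stochastic Extra-Gradient, SEG). From $z_0=(\theta_0,\mu_0)\in\mathbb R^d$, with data samples $w_1,w_2,\dots$ (the same sample is used in both steps of an iteration), for $k=0,1,2,\dots$: $$z_{k+1/2}=z_k-\eta_{k+1}H(z_k,w_{k+1}),\qquad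 z_{k+1}=z_k-\eta_{k+1}H(z_{k+1/2},w_{k+1}).$$ $\mathcal F_k$ denotes the natural filtration of $\{z_0,w_1,z_1,\dots,z_k\}$. Assumptions. (A1) $f$ is twice differentiable, convex in $\theta$ and concave in $\mu$. All eigenvalues of $Q^*$ have positive real part. There is an arbitrarily small neighborhood $\mathcal Z$ of $z^*$ such that, for a constant $C>0$, $\|H(z)-Q^*(z-z^* )\|_2\le C\|z-z^*\|_2^2$ for all $z\in\mathcal Z$, and in $\mathcal Z$ the function $f$ is strongly convex in $\theta$ and strongly concave in $\mu$, i.e. there is a constant $m>0$ with $H(z)^\top(z-z^* )\ge m\|z-z^*\|_2^2$ for all $z\in\mathcal Z$. (A2) There are a function $\mathcal V:\mathbb R^d\to[1,\infty)$ and constants $\alpha_0>2$, $C_{\mathcal V}>0$, $L_G>0$ such that $\mathbb E[\mathcal V(w)^{\alpha_0}]\le C_{\mathcal V}$ and, for all $w$ and all $z_1,z_2$, $\|H(z_1,w)-H(z_2,w)\|_2\le L_G\|z_1-z_2\|_2\,\mathcal V(w)$. (A3) $\{\xi(z_k,w_{k+1})\}_k$ is a martingale difference sequence, i.e. $\mathbb E[\xi(z_k,w_{k+1})\mid\mathcal F_k]=0$, and has locally bounded variance, i.e. for some constant $C>0$, $\mathbb E[\|\xi(z_k,w_{k+1})\|_2^2]\le C(1+\|z_k-z^*\|_2^2)$ and $\mathbb E[\|\xi(z_{k+1/2},w_{k+1})\|_2^2]\le C(1+\|z_{k+1/2}-z^*\|_2^2)$. *)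

(* Defs.v *)
From HB Require Import structures.
From mathcomp Require Import all_boot all_order all_algebra.
From mathcomp Require Import all_classical all_reals all_analysis.
From mathcomp Require Import measurable_realfun.
From mathcomp.real_closed Require Import complex.

Set Implicit Arguments.
Unset Strict Implicit.
Unset Printing Implicit Defensive.

Import Order.TTheory GRing.Theory Num.Theory.
Import numFieldNormedType.Exports.

Local Open Scope classical_set_scope.
Local Open Scope ring_scope.

(* The library norm on row vectors is the sup norm (it induces the usual
   topology); the quantitative hypotheses use the Euclidean norm below. *)
Definition dotv (R : realType) (n : nat) (u v : 'rV[R]_n) : R :=
  \sum_(i < n) u 0 i * v 0 i.

Definition norm2 (R : realType) (n : nat) (u : 'rV[R]_n) : R :=
  Num.sqrt (dotv u u).

(* R^n with its Borel sigma-algebra. *)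
Definition borel_rV (R : realType) (n : nat) :=
  g_sigma_algebraType (@open 'rV[R]_n).

Definition grad (R : realType) (n : nat) (f : 'rV[R]_n -> R) (z : 'rV[R]_n) :
    'rV[R]_n :=
  \row_(i < n) 'D_(delta_mx 0 i) f z.

Definition hessian (R : realType) (n : nat) (f : 'rV[R]_n -> R)
    (z : 'rV[R]_n) : 'M[R]_n :=
  \matrix_(i < n, j < n) 'D_(delta_mx 0 j) (fun y => grad f y 0 i) z.

Definition twice_differentiable (R : realType) (n : nat)
    (f : 'rV[R]_n -> R) : Prop :=
  (forall z, differentiable f z) /\ (forall z, differentiable (grad f) z).

Section MinMax.
Variables (R : realType) (dt dm : nat).
Local Notation vec := 'rV[R]_(dt + dm).

(* A point z = (theta, mu) is row_mx theta mu. *)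

(* (grad_theta g, - grad_mu g) *)
Definition saddle_field (g : vec -> R) (z : vec) : vec :=
  row_mx (lsubmx (grad g z)) (- rsubmx (grad g z)).

(* The Hessian with its mu-rows negated, i.e. the Jacobian of
   saddle_field g; it acts on column vectors. *)
Definition saddle_mx (g : vec -> R) (z : vec) : 'M[R]_(dt + dm) :=
  let h := hessian g z in
  block_mx (ulsubmx h) (ursubmx h) (- dlsubmx h) (- drsubmx h).

Definition saddle_point (f : vec -> R) (zs : vec) : Prop :=
  (forall theta : 'rV[R]_dt, f zs <= f (row_mx theta (rsubmx zs))) /\
  (forall mu : 'rV[R]_dm, f (row_mx (lsubmx zs) mu) <= f zs).

Definition convex_concave (f : vec -> R) : Prop :=
  (forall mu : 'rV[R]_dm,
    convex_function [set: convex_lmodType 'rV[R]_dt]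
      (fun theta => f (row_mx theta mu))) /\
  (forall theta : 'rV[R]_dt,
    convex_function [set: convex_lmodType 'rV[R]_dm]
      (fun mu => - f (row_mx theta mu))).

Definition eigenvalues_pos_re (n : nat) (Q : 'M[R]_n) : Prop :=
  forall lam : R[i],
    eigenvalue (map_mx (fun x : R => x%:C%C) Q) lam -> 0 < complex.Re lam.

Definition assumptionA1 (f : vec -> R) (zs : vec) : Prop :=
  let H := saddle_field f in
  let Q := saddle_mx f zs in
  [/\ twice_differentiable f,
      convex_concave f,
      eigenvalues_pos_re Q &
      exists Z : set vec, nbhs zs Z /\
        (exists2 C : R, 0 < C & forall z, Z z ->
          norm2 (H z - (z - zs) *m Q^T) <= C * norm2 (z - zs) ^+ 2) /\
        (exists2 m : R, 0 < m & forall z, Z z ->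
          m * norm2 (z - zs) ^+ 2 <= dotv (H z) (z - zs))].

(* rho is the law of the data sample w. *)
Definition assumptionA2 (rho : probability (borel_rV R (dt + dm)) R)
    (Hn : vec -> vec -> vec) : Prop :=
  exists (V : borel_rV R (dt + dm) -> R) (alpha0 CV LG : R),
    [/\ measurable_fun setT V /\ (forall w, 1 <= V w),
        2 < alpha0,
        0 < CV /\ 0 < LG,
        (\int[rho]_w ((V w) `^ alpha0)%:E <= CV%:E)%E &
        forall w z1 z2,
          norm2 (Hn z1 w - Hn z2 w) <= LG * norm2 (z1 - z2) * V w].

Section Iterates.
Variables (T : Type) (Hn : vec -> vec -> vec) (step : nat -> R).
Variables (z0 : T -> vec) (w : nat -> T -> vec).

Definition half_step (k : nat) (z : vec) (x : T) : vec :=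
  z - step k.+1 *: Hn z (w k.+1 x).

(* The sample w 0 is never used. *)
Fixpoint seg (k : nat) (x : T) : vec :=
  if k is j.+1 then
    seg j x - step k *: Hn (half_step j (seg j x) x) (w k x)
  else z0 x.

(* z_{k+1/2} *)
Definition seg_half (k : nat) (x : T) : vec := half_step k (seg k x) x.

Definition seg_avg (k : nat) (x : T) : vec :=
  k%:R^-1 *: \sum_(1 <= i < k.+1) seg i x.

(* The sigma-algebra generated by z_0, ..., z_k and w_1, ..., w_k. *)
Definition seg_filtration (k : nat) : set_system T :=
  <<s [set A | exists B : set (borel_rV R (dt + dm)), measurable B /\
        ((exists2 j, (j <= k)%N & A = seg j @^-1` B) \/
         (exists2 j, (1 <= j <= k)%N & A = w j @^-1` B))] >>.

End Iterates.

(* eta_k = eta k^{-a} *)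
Definition poly_step (eta a : R) (k : nat) : R := eta * k%:R `^ (- a).

End MinMax.

(* Y is a version of E[X | G], for G a sub-sigma-algebra and X measurable,
   either nonnegative (possibly with infinite integral) or integrable. Then
   the identity forces Y to be a.s. nonnegative, respectively integrable. *)
Definition is_cond_exp d (T : measurableType d) (R : realType)
    (P : probability T R) (G : set_system T) (X Y : T -> \bar R) : Prop :=
  (forall B : set (\bar R), measurable B -> G (Y @^-1` B)) /\
  (forall A, G A -> \int[P]_(x in A) Y x = \int[P]_(x in A) X x)%E.

(* The variance bounds are conditional on F_k = G k. As the half-step iterate
   zh k depends on w_{k+1}, it is not F_k-measurable, so in its bound both
   sides are conditioned. *)
Definition assumptionA3 d (T : measurableType d) (R : realType)
    (P : probability T R) (n : nat) (xi : 'rV[R]_n -> 'rV[R]_n -> 'rV[R]_n)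
    (zs : 'rV[R]_n) (G : nat -> set_system T)
    (z zh w : nat -> T -> 'rV[R]_n) (C : R) : Prop :=
  [/\ forall k (i : 'I_n),
        let X x := (xi (z k x) (w k.+1 x) 0 i)%:E in
        P.-integrable setT X /\ is_cond_exp P (G k) X (cst 0%E),
      forall k, exists2 Y,
        is_cond_exp P (G k)
          (fun x => (norm2 (xi (z k x) (w k.+1 x)) ^+ 2)%:E) Y &
        {ae P, forall x, (Y x <= (C * (1 + norm2 (z k x - zs) ^+ 2))%:E)%E} &
      forall k, exists Y D, [/\
        is_cond_exp P (G k)
          (fun x => (norm2 (xi (zh k x) (w k.+1 x)) ^+ 2)%:E) Y,
        is_cond_exp P (G k) (fun x => (norm2 (zh k x - zs) ^+ 2)%:E) D &
        {ae P, forall x, (Y x <= C%:E * (1 + D x))%E}]].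

(* Main.v *)
Require Import Defs.
From HB Require Import structures.
From mathcomp Require Import all_boot all_order all_algebra.
From mathcomp Require Import all_classical all_reals all_analysis.
From mathcomp Require Import measurable_realfun.
From mathcomp Require Import ring lra.

Set Implicit Arguments.
Unset Strict Implicit.
Unset Printing Implicit Defensive.

Import Order.TTheory GRing.Theory Num.Theory.
Import numFieldNormedType.Exports.

Local Open Scope classical_set_scope.
Local Open Scope ring_scope.

(* Since H is monotone and strongly monotone near z*, <H z, z - z*> is at least
   m |z - z*|^2 near z* and grows linearly away from it. Using the same sample
   twice in an iteration costs eta_k^2 V(w_k)^2 |z - z*|^2, a random amplification
   which may be correlated with the noise, but whose factors are summable in
   expectation. Dividing |z_k - z*|^2 by the product of the 1 + 4 eta_k^2 V(w_k)^2
   leaves enough slack to absorb both this amplification and its correlation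
   with the martingale increment, so that the scaled error is, up to summable
   deterministic factors, a nonnegative supermartingale with drift. The drift
   makes it small in probability at some late time, the maximal inequality keeps
   it small afterwards, and the product is almost surely bounded. The averages
   follow by Cesaro. *)

(** The samples share a law, but their independence from the past is not assumed, so the conditional
    expectation of [V (w k.+1 x) ^+ 2] times the squared error cannot be factored. The way out is a
    pathwise one-step bound [(1 + 4 * B) * (...)], with [B = (step k.+1 * V (w k.+1 x)) ^+ 2], whose
    bracket is free of [V]. Division by the random product cancels the outer factor before any
    integral is taken, and the bracket holds only terms controlled by the martingale and variance
    assumptions. In the recursion [V] then matters only through the sum of the [B], whose
    expectation is finite by marginal moments. Two more obstacles shape the proof. The start [z0]
    may have infinite second moment, so integrals are restricted to the events [err 0 x <= N%:R],
    known at time 0. Boundedness of the product is known at no finite time, so it stays outside the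
    integrals and enters only pathwise, to compare drift with error. Conditional inequalities are
    tested on events of the filtration, which allows infinite integrals. *)

Section EuclideanAlgebra.
Context {R : realType} {n : nat}.
Implicit Types (u v w : 'rV[R]_n) (t : R).

Lemma dotvv_ge0 u : 0 <= dotv u u.
Proof. by apply: sumr_ge0 => i _; rewrite -expr2 sqr_ge0. Qed.

Lemma norm2_sqr u : norm2 u ^+ 2 = dotv u u.
Proof. by rewrite sqr_sqrtr ?dotvv_ge0. Qed.

Lemma norm2_ge0 u : 0 <= norm2 u.
Proof. exact: sqrtr_ge0. Qed.

Lemma dotvC u v : dotv u v = dotv v u.
Proof. by apply: eq_bigr => i _; rewrite mulrC. Qed.

Lemma dotvDl u v w : dotv (u + v) w = dotv u w + dotv v w.
Proof. by rewrite -big_split; apply: eq_bigr => i _; rewrite mxE mulrDl. Qed.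

Lemma dotvZl t u v : dotv (t *: u) v = t * dotv u v.
Proof. by rewrite big_distrr; apply: eq_bigr => i _; rewrite mxE -mulrA. Qed.

Lemma dotvDr u v w : dotv u (v + w) = dotv u v + dotv u w.
Proof. by rewrite dotvC dotvDl !(dotvC u). Qed.

Lemma dotvZr t u v : dotv u (t *: v) = t * dotv u v.
Proof. by rewrite dotvC dotvZl dotvC. Qed.

Lemma dotvNl u v : dotv (- u) v = - dotv u v.
Proof. by rewrite -scaleN1r dotvZl mulN1r. Qed.

Lemma dotvNr u v : dotv u (- v) = - dotv u v.
Proof. by rewrite dotvC dotvNl dotvC. Qed.

Lemma dotvr0 u : dotv u 0 = 0.
Proof. by rewrite -(scale0r 0) dotvZr mul0r. Qed.

(** Sum over the coordinates of [t * (u 0 i - t^-1 * v 0 i) ^+ 2 >= 0]. The free weight [t] is later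
    chosen depending on the sample, so that a random factor lands on one side only. *)
Lemma dotv_young t u v : 0 < t ->
  2 * dotv u v <= t * dotv u u + t^-1 * dotv v v.
Proof.
move=> t0; rewrite !big_distrr -big_split /=; apply: ler_sum => i _.
have tt : t * t^-1 = 1 by rewrite divff// gt_eqF.
have := mulr_ge0 (ltW t0) (sqr_ge0 (u 0 i - t^-1 * v 0 i)).
have -> : t * (u 0 i - t^-1 * v 0 i) ^+ 2 = t * (u 0 i * u 0 i) -
   2 * (t * t^-1) * (u 0 i * v 0 i) + (t * t^-1) * (t^-1 * (v 0 i * v 0 i)).
  by ring.
rewrite tt; lra.
Qed.

Lemma dotvD_le u v : dotv (u + v) (u + v) <= 2 * dotv u u + 2 * dotv v v.
Proof.
rewrite dotvDl !dotvDr (dotvC v u).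
by have := @dotv_young 1 u v ltr01; rewrite invr1; lra.
Qed.

Lemma coord_le_norm2 u i : `|u 0 i| <= norm2 u.
Proof.
rewrite -sqrtr_sqr ler_wsqrtr// /dotv (bigD1 i)//= -expr2 lerDl.
by apply: sumr_ge0 => j _; rewrite -expr2 sqr_ge0.
Qed.

Lemma mx_normrE_row u : `|u| = \big[Num.max/0]_ij `|u ij.1 ij.2|.
Proof. exact: mx_normrE. Qed.

Lemma mx_norm_le (u : 'rV[R]_n) t : 0 <= t ->
  (forall i, `|u 0 i| <= t) -> `|u| <= t.
Proof.
move=> t0 ut; rewrite mx_normrE_row; apply: bigmax_le => //.
by move=> [i j] _ /=; rewrite ord1.
Qed.

Lemma mx_norm_le_norm2 u : `|u| <= norm2 u.
Proof. by apply: mx_norm_le (norm2_ge0 _) _ => i; exact: coord_le_norm2. Qed.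

Lemma coord_le_mx_norm u i : `|u 0 i| <= `|u|.
Proof.
by rewrite mx_normrE_row; apply/bigmax_geP; right; exists (0, i).
Qed.

Lemma dotv_le_mx_norm u t : 0 <= t -> (forall i, `|u 0 i| <= t) ->
  dotv u u <= n%:R * t ^+ 2.
Proof.
move=> t0 ut; rewrite mulr_natl -[X in _ *+ X]card_ord -sumr_const.
apply: ler_sum => i _; rewrite -expr2 -real_normK ?num_real//.
by rewrite lerXn2r// nnegrE.
Qed.

End EuclideanAlgebra.

(** * Borel measurability of vector-valued maps by lattice approximation *)

Section BorelVectors.
Context {R : realType} {n : nat}.
Implicit Types (x y : 'rV[R]_n).

(** Index of the lattice cell of mesh [k.+1%:R^-1] containing [x]. The indices form a countable
    type, so rounding gives countably-valued approximations of a random vector. *)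
Definition grid k x : 'rV[int]_n := \row_i Num.floor (x 0 i * k.+1%:R).

Definition grid_node k (q : 'rV[int]_n) : 'rV[R]_n :=
  \row_i ((q 0 i)%:~R / k.+1%:R).

Lemma grid_node_close k x : `|x - grid_node k (grid k x)| <= k.+1%:R^-1.
Proof.
apply: mx_norm_le => // i; rewrite !mxE.
have k0 : 0 < k.+1%:R :> R by [].
have -> : x 0 i - (Num.floor (x 0 i * k.+1%:R))%:~R / k.+1%:R =
    (x 0 i * k.+1%:R - (Num.floor (x 0 i * k.+1%:R))%:~R) / k.+1%:R.
  by rewrite mulrBl mulfK ?gt_eqF.
rewrite normrM [`|_^-1|]gtr0_norm ?invr_gt0// -[leRHS]mul1r.
rewrite ler_wpM2r ?invr_ge0// ger0_norm ?subr_ge0 ?floor_le//.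
by have := floorD1_gt (x 0 i * k.+1%:R); rewrite intrD; lra.
Qed.

Lemma cvg_grid_node x : grid_node k (grid k x) @[k --> \oo] --> x.
Proof.
apply/cvgrPdist_le => e e0; have := @cvg_harmonic R.
move=> /cvgrPdist_le/(_ _ e0); apply: filterS => k.
rewrite /= sub0r normrN => h; apply: le_trans (grid_node_close k x) _.
exact: le_trans (ler_norm _) h.
Qed.

Lemma measurable_grid d (T : measurableType d) (X : T -> 'rV[R]_n) k q :
  (forall i, measurable_fun setT (fun t => X t 0 i)) ->
  measurable [set t | grid k (X t) = q].
Proof.
move=> mX.
have -> : [set t | grid k (X t) = q] =
    \bigcap_(i in [set: 'I_n])
      ((fun t => X t 0 i * k.+1%:R) @^-1` `[(q 0 i)%:~R, (q 0 i + 1)%:~R[).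
  apply/seteqP; split=> [t <- i _|t tq].
    by rewrite /= mxE in_itv/= floor_le floorD1_gt.
  apply/rowP => i; rewrite mxE; apply/floor_def.
  by have := tq i I; rewrite /= in_itv.
apply: fin_bigcap_measurable => [|i _]; first exact: finite_finset.
 rewrite -[X in measurable X]setTI.
by apply: measurable_funM => //; exact: measurable_itv.
Qed.

Lemma continuous_measurable_rV d (T : measurableType d)
    (X : T -> borel_rV R n) (phi : 'rV[R]_n -> R) :
  continuous phi -> measurable_fun setT X ->
  measurable_fun setT (fun t => phi (X t)).
Proof.
move=> cphi mX; apply: (measurability _ (RGenOInfty.measurableE R)).
move=> _ [_ [a ->] <-]; rewrite setTI.
have : measurable (X @^-1` (phi @^-1` `]a, +oo[%classic)).
  rewrite -[X in measurable X]setTI; apply: mX => //.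
  apply: sub_sigma_algebra; apply: open_comp => // x _; exact: cphi.
by [].
Qed.

Lemma measurable_coord d (T : measurableType d) (X : T -> borel_rV R n) i :
  measurable_fun setT X -> measurable_fun setT (fun t => X t 0 i).
Proof.
by apply: (@continuous_measurable_rV _ _ X (fun x => x 0 i)) => x;
  exact: coord_continuous.
Qed.

(** An open set is the union of the cells contained in it, over all meshes. There are countably many
    cells, and lying in one of them is a condition on coordinates. *)
Lemma measurable_rV d (T : measurableType d) (X : T -> borel_rV R n) :
  (forall i, measurable_fun setT (fun t => X t 0 i)) -> measurable_fun setT X.
Proof.
move=> mX; apply: (@measurability _ _ _ _ _ X (@open 'rV[R]_n)) => //.
move=> _ [U oU <-]; rewrite setTI.
pose I := {kq : nat * 'rV[int]_n |
  `[< forall x, grid kq.1 x = kq.2 -> U x >]}.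
have -> : X @^-1` U =
    \bigcup_(i : I) [set t | grid (val i).1 (X t) = (val i).2].
  apply/seteqP; split=> [t Ut|t [[[k q] /= /asboolP kqU]] _ /= Xq]; last first.
    exact: kqU.
  have /nbhs_ballP[e /= e0 eU] : nbhs (X t : 'rV[R]_n) U.
    exact: open_nbhs_nbhs.
  (* With mesh below [e / 2], two points of one cell are each within the mesh of its node, so the
     cell of [X t] lies in the ball of radius [e] around [X t]. *)
  have /cvgrPdist_lt/(_ (e / 2)) := @cvg_harmonic R.
  rewrite divr_gt0// => /(_ isT)[k _ /(_ k (leqnn k))].
  rewrite /= sub0r normrN ger0_norm// => ke.
  have kU : `[< forall x, grid k x = grid k (X t) -> U x >].
    apply/asboolP => x xt; apply: eU; rewrite mx_norm_ball /ball_/=.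
    rewrite -[X t : 'rV[R]_n](subrK (grid_node k (grid k (X t)))) -addrA.
    apply: le_lt_trans (ler_normD _ _) _; rewrite [ltRHS]splitr ltrD//.
      exact: le_lt_trans (grid_node_close _ _) ke.
    rewrite -xt distrC; exact: le_lt_trans (grid_node_close _ _) ke.
  by exists (exist _ (k, grid k (X t)) kU).
apply: countable_bigcupT_measurable; first exact: countableP.
by move=> i; exact: measurable_grid.
Qed.

(** With the first argument rounded to a node the map is measurable on each of countably many cells,
    and continuity in that argument gives the pointwise limit. This serves for the noisy field at a
    random iterate and a random sample, which is regular in each argument separately. *)
Lemma measurable_caratheodory d d' (T : measurableType d)
    (U : measurableType d') (phi : 'rV[R]_n -> U -> R)
    (X : T -> borel_rV R n) (W : T -> U) :
  (forall u, continuous (phi^~ u)) ->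
  (forall x, measurable_fun setT (phi x)) ->
  measurable_fun setT X -> measurable_fun setT W ->
  measurable_fun setT (fun t => phi (X t) (W t)).
Proof.
move=> cphi mphi mX mW.
pose h k t := phi (grid_node k (grid k (X t))) (W t).
apply: (@measurable_fun_cvg _ _ _ _ h) => [k|t _]; last first.
  have := @cvg_grid_node (X t).
  move=> /(@cvg_comp _ _ _ _ (phi^~ (W t))); apply; exact: cphi.
move=> _ Y mY; rewrite setTI.
have -> : h k @^-1` Y = \bigcup_q ([set t | grid k (X t) = q] `&`
    (fun t => phi (grid_node k q) (W t)) @^-1` Y).
  apply/seteqP; split=> [t hY|t [q _ [/= <-]]//].
  by exists (grid k (X t)).
apply: countable_bigcupT_measurable; first exact: countableP.
move=> q; apply: measurableI.
  by apply: measurable_grid => i; exact: measurable_coord.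
rewrite -[X in measurable X]setTI.
exact: (measurableT_comp (mphi (grid_node k q)) mW).
Qed.

End BorelVectors.

Lemma cvgn_le {R : realType} (u : R^nat) (l c : R) :
  u @ \oo --> l -> (forall k, u k <= c) -> l <= c.
Proof.
move=> ul uc; apply: (@closed_cvg _ _ \oo _ u (fun x => x <= c)) ul.
  exact: closed_le.
by near=> k; exact: uc.
Unshelve. all: by end_near. Qed.

(** * Directional derivatives and first-order convexity *)

Section DirectionalDerivatives.
Context {R : realType} {n : nat}.
Implicit Types (g : 'rV[R]_n -> R) (x v : 'rV[R]_n).

(** The increments [k.+1%:R^-1] turn a derivative into the limit of a sequence, so that
    measurability and integral bounds pass to it. *)
Lemma cvg_derive_harmonic g x v : derivable g x v ->
  k.+1%:R * (g (k.+1%:R^-1 *: v + x) - g x) @[k --> \oo] --> 'D_v g x.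
Proof.
move=> gx; have := gx; rewrite /derivable => /cvgr_dnbhsP.
move=> /(_ (fun k => k.+1%:R^-1)) gk.
rewrite (_ : (fun k => _) = fun k => (k.+1%:R^-1)^-1 *:
  ((g \o shift x) (k.+1%:R^-1 *: v) - g x)); last first.
  by apply/funext => k; rewrite invrK.
by apply: gk; split; [move=> k; rewrite invr_eq0|exact: cvg_harmonic].
Qed.

Lemma deriveE_dotv g x v : differentiable g x -> 'D_v g x = dotv (grad g x) v.
Proof.
move=> gx; rewrite deriveE// {1}[v]row_sum_delta linear_sum.
apply: eq_bigr => i _; rewrite linearZ/= mxE deriveE// mulrC.
by [].
Qed.

Lemma is_derive_line g x v t : differentiable g (t *: v + x) ->
  is_derive t (1 : R) (fun s => g (s *: v + x)) ('D_v g (t *: v + x)).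
Proof.
move=> gx; have qE : (fun h : R => h^-1 *: (((fun s => g (s *: v + x)) \o
      shift t) (h *: 1) - g (t *: v + x))) =
    (fun h => h^-1 *: ((g \o shift (t *: v + x)) (h *: v) - g (t *: v + x))).
  by apply/funext => h /=; rewrite scaler1 scalerDl addrA.
split; last by rewrite /derive qE.
by rewrite /derivable qE; exact: diff_derivable.
Qed.

(** Convexity bounds every difference quotient along the segment by [g (v + x) - g x], and the bound
    survives the limit. *)
Lemma grad_convex_le g x v : differentiable g x ->
  (forall t, 0 < t <= 1 -> g (t *: v + x) <= (1 - t) * g x + t * g (v + x)) ->
  dotv (grad g x) v <= g (v + x) - g x.
Proof.
move=> gx gconv; rewrite -deriveE_dotv//.
apply: cvgn_le (cvg_derive_harmonic (diff_derivable gx)) _ => k.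
have k0 : 0 < k.+1%:R :> R by [].
rewrite -ler_pdivlMl//; set t := k.+1%:R^-1.
have := gconv t; rewrite invr_gt0 k0 invf_le1// ler1n => /(_ isT).
by rewrite mulrBr mulrBl mul1r; lra.
Qed.

Lemma convex_functionT_le (h : 'rV[R]_n -> R) t x y :
  convex_function [set: convex_lmodType 'rV[R]_n] h -> 0 <= t <= 1 ->
  h (t *: y + (1 - t) *: x) <= t * h y + (1 - t) * h x.
Proof.
move=> hconv /andP[t0 t1].
by have := hconv (Itv01 t0 t1) y x; rewrite !inE convRE; apply.
Qed.

End DirectionalDerivatives.

(** * Monotonicity and coercivity of the saddle field *)

Section SaddleField.
Context {R : realType} {dt dm : nat}.
Local Notation vec := 'rV[R]_(dt + dm).
Implicit Types (f g : vec -> R) (z v : vec).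

Lemma saddle_field_coord g z i : saddle_field g z 0 i =
  if (i < dt)%N then grad g z 0 i else - grad g z 0 i.
Proof.
rewrite /saddle_field; case: (split_ordP i) => j ->.
  by rewrite row_mxEl mxE.
by rewrite row_mxEr mxE [in LHS]mxE.
Qed.

Lemma dotv_row_mx (t1 t2 : 'rV[R]_dt) (m1 m2 : 'rV[R]_dm) :
  dotv (row_mx t1 m1) (row_mx t2 m2) = dotv t1 t2 + dotv m1 m2.
Proof.
rewrite /dotv big_split_ord /=; congr (_ + _); apply: eq_bigr => i _.
  by rewrite !row_mxEl.
by rewrite !row_mxEr.
Qed.

(** Four first-order inequalities, in [theta] and in [mu], at [z1] and at [z2], all aim at the two
    mixed points (theta2, mu1) and (theta1, mu2). On adding them every value of [f] cancels. *)
Lemma saddle_field_monotone f z1 z2 : convex_concave f ->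
  differentiable f z1 -> differentiable f z2 ->
  0 <= dotv (saddle_field f z1 - saddle_field f z2) (z1 - z2).
Proof.
move=> [fconv fconc] df1 df2.
have rowE (z v : vec) (t : R) :
    row_mx (t *: lsubmx v + lsubmx z) (t *: rsubmx v + rsubmx z) = t *: v + z.
  by rewrite -[v in RHS]hsubmxK -[z in RHS]hsubmxK scale_row_mx add_row_mx.
have half_theta (z : vec) (th : 'rV_dt) : differentiable f z ->
    dotv (lsubmx (grad f z)) (th - lsubmx z) <=
    f (row_mx th (rsubmx z)) - f z.
  move=> dz; pose v : vec := row_mx (th - lsubmx z) 0.
  have vzE t : t *: v + z = row_mx (t *: th + (1 - t) *: lsubmx z) (rsubmx z).
    rewrite -rowE row_mxKl row_mxKr scaler0 add0r; congr row_mx.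
    by apply/rowP => i; rewrite !mxE; ring.
  have -> : dotv (lsubmx (grad f z)) (th - lsubmx z) = dotv (grad f z) v.
    rewrite -[grad f z in RHS]hsubmxK dotv_row_mx dotvr0 addr0.
    by [].
  have -> : row_mx th (rsubmx z) = v + z.
    by rewrite -[v]scale1r vzE subrr scale0r addr0 scale1r.
  apply: grad_convex_le => // t /andP[t0 t1].
  have := convex_functionT_le (lsubmx z) th (fconv (rsubmx z)).
  move=> /(_ t); rewrite (ltW t0) t1 -vzE => /(_ isT) /le_trans; apply.
  by rewrite hsubmxK -[v in leRHS]scale1r vzE subrr scale0r addr0 scale1r addrC.
(* Concavity in [mu] is convexity of [- f], along a direction whose [theta] block is zero. *)
have half_mu (z : vec) (mu : 'rV_dm) : differentiable f z ->
    f (row_mx (lsubmx z) mu) - f z <=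
    dotv (rsubmx (grad f z)) (mu - rsubmx z).
  move=> dz; pose v : vec := row_mx 0 (mu - rsubmx z).
  have vzE t : t *: v + z = row_mx (lsubmx z) (t *: mu + (1 - t) *: rsubmx z).
    rewrite -rowE row_mxKl row_mxKr scaler0 add0r; congr row_mx.
    by apply/rowP => i; rewrite !mxE; ring.
  have -> : dotv (rsubmx (grad f z)) (mu - rsubmx z) =
      - dotv (grad (- f) z) v.
    have -> : grad (- f) z = - grad f z.
      by apply/rowP => i; rewrite !mxE deriveN//; exact: diff_derivable.
    rewrite dotvNl opprK.
    rewrite -[grad f z in RHS]hsubmxK dotv_row_mx dotvr0 add0r.
    by [].
  have -> : row_mx (lsubmx z) mu = v + z.
    by rewrite -[v]scale1r vzE subrr scale0r addr0 scale1r.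
  have dfN : differentiable (- f) z by exact: differentiableN.
  suff : dotv (grad (- f) z) v <= (- f) (v + z) - (- f) z.
    have -> : (- f) (v + z) - (- f) z = - f (v + z) - - f z by [].
    lra.
  apply: grad_convex_le => // t /andP[t0 t1].
  have := convex_functionT_le (rsubmx z) mu (fconc (lsubmx z)).
  move=> /(_ t); rewrite (ltW t0) t1 -vzE => /(_ isT) /le_trans; apply.
  by rewrite hsubmxK -[v in leRHS]scale1r vzE subrr scale0r addr0 scale1r addrC.
have := half_theta z1 (lsubmx z2) df1; have := half_theta z2 (lsubmx z1) df2.
have := half_mu z1 (rsubmx z2) df1; have := half_mu z2 (rsubmx z1) df2.
rewrite -[z1 - z2]hsubmxK opp_row_mx add_row_mx dotv_row_mx !linearB /=.
move: (f (row_mx _ _)) (f (row_mx _ _)) (f z1) (f z2).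
move: (lsubmx z1) (lsubmx z2) (rsubmx z1) (rsubmx z2) (lsubmx (grad f z1))
  (lsubmx (grad f z2)) (rsubmx (grad f z1)) (rsubmx (grad f z2)).
move=> t1 t2 m1 m2 a1 a2 b1 b2 f21 f12 f1 f2.
rewrite !(dotvDl, dotvDr, dotvNl, dotvNr).
move: (dotv _ _) (dotv _ _) (dotv _ _) (dotv _ _) (dotv _ _) (dotv _ _)
  (dotv _ _) (dotv _ _) => *; lra.
Qed.

(** Outside the ball of radius [r], monotonicity between [z] and its radial projection on the sphere
    transfers the bound outwards, so the inner product grows at least linearly, like
    [m * r * norm2 (z - zs)]. *)
Lemma saddle_field_growth f zs r m : convex_concave f ->
  (forall z, differentiable f z) -> 0 < r -> 0 < m ->
  (forall z, norm2 (z - zs) <= r ->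
    m * norm2 (z - zs) ^+ 2 <= dotv (saddle_field f z) (z - zs)) ->
  forall z, m * Num.min 1 (r / norm2 (z - zs)) * norm2 (z - zs) ^+ 2 <=
    dotv (saddle_field f z) (z - zs).
Proof.
move=> fcc df r0 m0 near_zs z; set u := z - zs; set t := Num.min _ _.
have [ur|ru] := leP (norm2 u) r.
  apply: le_trans (near_zs _ ur).
  by rewrite -mulrA ler_pM2l// ler_piMl ?sqr_ge0// ge_min lexx.
have u0 : 0 < norm2 u by exact: lt_trans ru.
have tE : t = r / norm2 u by rewrite /t min_r// ler_pdivrMr// mul1r ltW.
have t0 : 0 < t by rewrite tE divr_gt0.
have t1 : t < 1 by rewrite tE ltr_pdivrMr// mul1r.
(* The point of the segment from [zs] to [z] at distance exactly [r] from [zs], where [near_zs]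
   still applies. *)
pose y := zs + t *: u.
have yzs : y - zs = t *: u by rewrite /y addrC addKr.
have := near_zs y; rewrite yzs norm2_sqr dotvZl !dotvZr.
have -> : norm2 (t *: u) = r.
  rewrite /norm2 dotvZl dotvZr mulrA -expr2 sqrtrM ?sqr_ge0// sqrtr_sqr.
  by rewrite gtr0_norm// tE divfK// gt_eqF.
move=> /(_ (lexx _)) Hy.
have := saddle_field_monotone fcc (df z) (df y).
have -> : z - y = (1 - t) *: u.
  by rewrite scalerBl scale1r /y opprD addrA.
rewrite dotvZr dotvDl dotvNl pmulr_rge0 ?subr_gt0// norm2_sqr => mono.
move: (dotv (saddle_field f y) u) (dotv (saddle_field f z) u) (dotv u u) Hy mono.
move=> gy gz uu Hy mono; apply: (@le_trans _ _ gy); last by rewrite -subr_ge0.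
rewrite -(ler_pM2l t0) (le_trans _ Hy)//.
by rewrite le_eqVlt; apply/orP; left; apply/eqP; ring.
Qed.

End SaddleField.

(** * Gradient of an expectation *)

Section RandomFields.
Context d (U : measurableType d) (R : realType) (rho : {measure set U -> \bar R}).
Context {n : nat}.
Variable F : 'rV[R]_n -> U -> R.
Hypothesis F_differentiable : forall w z, differentiable (F^~ w) z.

Lemma measurable_grad z i : (forall y, measurable_fun setT (F y)) ->
  measurable_fun setT (fun w => grad (F^~ w) z 0 i).
Proof.
move=> mF; pose h k w :=
  k.+1%:R * (F (k.+1%:R^-1 *: delta_mx 0 i + z) w - F z w).
apply: (@measurable_fun_cvg _ _ _ _ h) => [k|w _].
  by apply: measurable_funM => //; exact: measurable_funB.
rewrite mxE; apply: cvg_derive_harmonic.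
exact/diff_derivable/F_differentiable.
Qed.

(** The mean value theorem is applied to the single function [psi], so that both directional
    derivatives are taken at the same parameter. Applied to the two increments separately, it would
    give unrelated parameters, which [c] does not compare. *)
Lemma increment_le (w : U) z1 z2 v h c : 0 < h ->
  (forall s, `|'D_v (F^~ w) (s *: v + z1) - 'D_v (F^~ w) (s *: v + z2)| <= c) ->
  `|(F (h *: v + z1) w - F z1 w) - (F (h *: v + z2) w - F z2 w)| <= c * h.
Proof.
move=> h0 Dc; pose psi s := F (s *: v + z1) w - F (s *: v + z2) w.
have dpsi s : is_derive s (1 : R) psi
    ('D_v (F^~ w) (s *: v + z1) - 'D_v (F^~ w) (s *: v + z2)).
  by apply: is_deriveB; apply: is_derive_line; exact: F_differentiable.
have cpsi : {within `[0, h], continuous psi}.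
  by apply: derivable_within_continuous => x _; exact: ex_derive.
have [x _] := MVT h0 (fun x _ => dpsi x) cpsi.
rewrite subr0 /psi !scale0r !add0r => E.
rewrite (_ : _ - _ - _ = psi h - (F z1 w - F z2 w)); last by rewrite /psi; ring.
by rewrite E normrM (gtr0_norm h0) ler_wpM2r// ltW.
Qed.

(** Differentiation under the integral is bypassed: difference quotients of [f] are integrals of
    those of [F], bounded through [c * V w] uniformly in the increment, and the limit keeps the
    bound. This is what makes the mean field globally Lipschitz. *)
Lemma grad_integral_lipschitz (f : 'rV[R]_n -> R) (V : U -> R) (z1 z2 : 'rV[R]_n)
    (c : R) i :
  (forall z, rho.-integrable setT (EFin \o F z)) ->
  (forall z, f z = \int[rho]_w F z w) ->
  (forall z, differentiable f z) ->
  rho.-integrable setT (EFin \o V) ->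
  (forall w s, `|grad (F^~ w) (s *: delta_mx 0 i + z1) 0 i -
    grad (F^~ w) (s *: delta_mx 0 i + z2) 0 i| <= c * V w) ->
  `|grad f z1 0 i - grad f z2 0 i| <= c * \int[rho]_w V w.
Proof.
move=> iF fE df iV lip; set v := delta_mx 0 i in lip.
pose q k z := k.+1%:R * (f (k.+1%:R^-1 *: v + z) - f z).
have cq z : q k z @[k --> \oo] --> grad f z 0 i.
  by rewrite mxE; apply: cvg_derive_harmonic; exact/diff_derivable/df.
apply: (@cvgn_le _ (fun k => `|q k z1 - q k z2|)) => [|k].
  by apply: cvg_norm; apply: cvgB.
have k0 : 0 < k.+1%:R :> R by [].
have iB z y : rho.-integrable setT (EFin \o (fun w => F z w - F y w)).
  by apply: eq_integrable (integrableB _ (iF z) (iF y)).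
pose h : R := k.+1%:R^-1.
have h0 : 0 < h by rewrite invr_gt0.
rewrite /q -/h -mulrBr normrM (gtr0_norm k0) -ler_pdivlMl// -/h.
rewrite !fE -!RintegralB//.
apply: (le_trans (le_normr_Rintegral _ _)) => //.
  by apply: eq_integrable (integrableB _ (iB _ _) (iB _ _)).
rewrite mulrA -RintegralZl//; apply: le_Rintegral => //.
- apply: integrable_norm.
  by apply: eq_integrable (integrableB _ (iB _ _) (iB _ _)).
- by apply: eq_integrable (integrableZl _ (h * c) iV).
move=> w _; have -> : h * c * V w = (c * V w) * h by ring.
apply: increment_le => // s; have := lip w s; rewrite !mxE; exact.
Qed.

End RandomFields.

(** * Sup norm against Euclidean norm *)

Section SaddleLipschitz.
Context {R : realType} {dt dm : nat}.
Local Notation vec := 'rV[R]_(dt + dm).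

(** The crude constant [n.+1] replaces the square root of [n]; it is positive even for [n = 0], so
    it can serve as a divisor. *)
Lemma norm2_le_mx_norm n (u : 'rV[R]_n) : norm2 u <= n.+1%:R * `|u|.
Proof.
rewrite -(ler_pXn2r (n := 2))// ?nnegrE ?norm2_ge0 ?mulr_ge0// norm2_sqr.
apply: le_trans (dotv_le_mx_norm (normr_ge0 u) (coord_le_mx_norm u)) _.
rewrite exprMn ler_wpM2r ?sqr_ge0// -natrX ler_nat.
by rewrite (leq_trans (leqnSn n))// -[leqLHS]expn1 leq_pexp2l.
Qed.

Lemma lipschitz_coord_continuous n (g : 'rV[R]_n -> 'rV[R]_n) (c : R) i :
  (forall x y, norm2 (g x - g y) <= c * norm2 (x - y)) ->
  continuous (fun x => g x 0 i).
Proof.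
move=> gc x; apply/(@cvgrPdist_le _ _ _ (nbhs x) (nbhs_filter x)) => e e0.
have c0 : 0 < (`|c| + 1) * n.+1%:R by rewrite mulr_gt0// ltr_wpDl.
near=> y; have : `|x - y| <= e / ((`|c| + 1) * n.+1%:R).
  near: y; apply/nbhs_ballP; exists (e / ((`|c| + 1) * n.+1%:R)) => /=.
    by rewrite divr_gt0.
  by move=> y; rewrite mx_norm_ball => /ltW.
rewrite ler_pdivlMr// => xy; have := coord_le_norm2 (g x - g y) i.
rewrite !mxE => /le_trans; apply; apply: le_trans (gc _ _) _.
apply: le_trans xy; rewrite mulrC (mulrC `|_|) -mulrA.
apply: (@le_trans _ _ ((`|c| + 1) * norm2 (x - y))).
  rewrite mulrC ler_wpM2r ?norm2_ge0//.
  by rewrite (le_trans (ler_norm c))// lerDl.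
by rewrite ler_wpM2l ?addr_ge0//; exact: norm2_le_mx_norm.
Unshelve. all: by end_near. Qed.

Lemma saddle_field_diff_coord (g h : vec -> R) z1 z2 i :
  `|(saddle_field g z1 - saddle_field h z2) 0 i| =
  `|grad g z1 0 i - grad h z2 0 i|.
Proof.
rewrite mxE [X in _ + X]mxE !saddle_field_coord; case: ifP => // _.
by rewrite -opprD normrN.
Qed.

End SaddleLipschitz.

Import HBNNSimple.

(** * Weights measurable for a sub-sigma-algebra *)

Section SubSigmaAlgebra.
Context d (T : measurableType d) (R : realType) (P : probability T R).
Variable Gen : set_system T.
Hypothesis Gen_measurable : Gen `<=` measurable.
Local Notation G := <<s Gen>>.
Local Notation TG := (g_sigma_algebraType Gen).

Lemma gen_measurable A : G A -> measurable A.
Proof. by apply: smallest_sub => //; exact: sigma_algebra_measurable. Qed.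

Lemma adapted_measurable d' (U : measurableType d') (X : T -> U) :
  measurable_fun setT (X : TG -> U) -> measurable_fun setT X.
Proof.
by move=> mX _ Y mY; apply: gen_measurable; exact: mX.
Qed.

Lemma nnsfun_preimage1 (h : {nnsfun TG >-> R}) y :
  G ((h : TG -> R) @^-1` [set y]).
Proof. exact: (measurable_funPTI h (measurable_set1 y)). Qed.

(** The level sets of [h] belong to [G], so each value comes out of the integral and only integrals
    of [X] over events of [G] remain. *)
Lemma integral_nnsfun_mul (h : {nnsfun TG >-> R}) (X : T -> R) A :
  measurable_fun setT X -> (forall x, 0 <= X x) -> G A ->
  (\int[P]_(x in A) ((h : TG -> R) x * X x)%:E =
   \sum_(y \in range (h : TG -> R)) y%:E *
     \int[P]_(x in A `&` (h : TG -> R) @^-1` [set y]) (X x)%:E)%E.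
Proof.
move=> mX X0 GA; have mA := gen_measurable GA.
have mh y : measurable ((h : TG -> R) @^-1` [set y] : set T).
  by apply: gen_measurable; exact: nnsfun_preimage1.
under eq_integral => x _.
  rewrite fimfunE EFinM -fsumEFin// ge0_mule_fsuml; last first.
    move=> y; exact: nnfun_muleindic_ge0.
  over.
rewrite ge0_integral_fsum//; last 2 first.
- move=> y; apply/measurable_EFinP; apply: measurable_funTS.
  by do 2 apply: measurable_funM => //.
- by move=> y x _; rewrite mule_ge0 ?lee_fin//; exact: nnfun_muleindic_ge0.
apply: eq_fsbigr => y /set_mem[x _ xy].
under eq_integral do rewrite EFinM -muleA.
rewrite ge0_integralZl//; last 3 first.
- apply/measurable_EFinP; apply: measurable_funTS.
  by apply: measurable_funM => //.
- by move=> z _; rewrite lee_fin mulr_ge0.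
- by rewrite lee_fin -xy.
rewrite integral_mkcondr; congr (_ * _)%E; apply: eq_integral => z _.
by rewrite epatch_indic muleC.
Qed.

Lemma cvg_integral_approx (phi X : T -> R) A
    (mphi : measurable_fun setT (EFin \o (phi : TG -> R))) :
  (forall x, 0 <= phi x) ->
  measurable_fun setT X -> (forall x, 0 <= X x) -> G A ->
  (\int[P]_(x in A) ((nnsfun_approx measurableT mphi k : TG -> R) x * X x)%:E @[k --> \oo] -->
   \int[P]_(x in A) (phi x * X x)%:E)%E.
Proof.
move=> phi0 mX X0 GA; have mA := gen_measurable GA.
set h := nnsfun_approx _ _.
have mh k : measurable_fun setT ((h k : TG -> R) : T -> R).
  by apply: adapted_measurable; exact: measurable_funP.
rewrite (eq_integral (fun x : T => limn (fun k => ((h k : TG -> R) x * X x)%:E))).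
  apply: cvg_monotone_convergence => //.
  - by move=> k; apply/measurable_EFinP; apply: measurable_funTS; exact: measurable_funM.
  - by move=> k x _; rewrite lee_fin mulr_ge0.
  - move=> x _ m k mk; rewrite lee_fin ler_wpM2r//.
    by move: (nd_nnsfun_approx measurableT mphi mk) => /lefP.
move=> x _; apply/esym/cvg_lim => //.
apply: cvg_EFin; first by near=> k.
apply: cvgM; last exact: cvg_cst.
have := cvg_nnsfun_approx measurableT mphi (fun x _ => phi0 x) (x := x) Logic.I.
by move/fine_cvg.
Unshelve. all: by end_near. Qed.

(** Taking out what is known, for inequalities: simple weights reduce to events of [G], and monotone
    convergence reaches [phi]. Both sides may be infinite. *)
Lemma le_integral_weighted (phi X Y : T -> R) :
  measurable_fun setT (phi : TG -> R) -> (forall x, 0 <= phi x) ->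
  measurable_fun setT X -> (forall x, 0 <= X x) ->
  measurable_fun setT Y -> (forall x, 0 <= Y x) ->
  (forall A, G A ->
    \int[P]_(x in A) (X x)%:E <= \int[P]_(x in A) (Y x)%:E)%E ->
  forall A, G A ->
    (\int[P]_(x in A) (phi x * X x)%:E <= \int[P]_(x in A) (phi x * Y x)%:E)%E.
Proof.
move=> mphi phi0 mX X0 mY Y0 XY A GA.
have mphiE : measurable_fun setT (EFin \o (phi : TG -> R)).
  exact/measurable_EFinP.
have cX := cvg_integral_approx mphiE phi0 mX X0 GA.
have cY := cvg_integral_approx mphiE phi0 mY Y0 GA.
apply: (lee_cvg_to cX cY); near=> k.
rewrite !integral_nnsfun_mul//; apply: lee_fsum => // y [x _ <-].
apply: lee_wpmul2l; first by rewrite lee_fin.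
apply: XY; apply: (@measurableI _ TG) => //; exact: nnsfun_preimage1.
Unshelve. all: by end_near. Qed.

(** Zero integrals over [G] mean that [xi^\+] and [xi^\-] have equal integrals on events of [G],
    hence also after weighting by [phi^\+] or [phi^\-]. The product has positive part
    [phi^\+ xi^\+ + phi^\- xi^\-] and negative part [phi^\+ xi^\- + phi^\- xi^\+], and exchanging
    [xi^\+] with [xi^\-] turns one into the other. *)
Lemma integral_martingale_weighted (phi xi : T -> R) A :
  measurable_fun setT (phi : TG -> R) -> P.-integrable setT (EFin \o xi) ->
  (forall B, G B -> \int[P]_(x in B) (xi x)%:E = 0)%E ->
  G A -> P.-integrable A (fun x => (phi x * xi x)%:E) ->
  (\int[P]_(x in A) (phi x * xi x)%:E = 0)%E.
Proof.
move=> mphi ixi xi0 GA iphixi; have mA := gen_measurable GA.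
have mxi : measurable_fun setT xi.
  by apply/measurable_EFinP; exact: measurable_int ixi.
have mxip := measurable_funrpos mxi; have mxin := measurable_funrneg mxi.
have mphip : measurable_fun setT (phi^\+ : TG -> R) by exact: measurable_funrpos.
have mphin : measurable_fun setT (phi^\- : TG -> R) by exact: measurable_funrneg.
have xipn B : G B -> (\int[P]_(x in B) (xi^\+ x)%:E =
    \int[P]_(x in B) (xi^\- x)%:E)%E.
  move=> GB; have mB := gen_measurable GB; have := xi0 B GB.
  have ixiB : P.-integrable B (EFin \o xi) by exact: integrableS ixi.
  have fp := integrable_fin_num mB (integrable_funrpos mB ixiB).
  have fn := integrable_fin_num mB (integrable_funrneg mB ixiB).
  rewrite integralE (funerpos xi) (funerneg xi) -(fineK fp) -(fineK fn) => -[].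
  by move/eqP; rewrite subr_eq0 => /eqP ->.
have swap (psi : T -> R) : measurable_fun setT (psi : TG -> R) ->
    (forall x, 0 <= psi x) ->
    (\int[P]_(x in A) (psi x * xi^\+ x)%:E =
     \int[P]_(x in A) (psi x * xi^\- x)%:E)%E.
  move=> mpsi psi0; apply/eqP; rewrite eq_le; apply/andP; split;
    by apply: le_integral_weighted => // B /xipn ->.
have m1 (u v : T -> R) : measurable_fun setT (u : TG -> R) ->
    measurable_fun setT v -> measurable_fun A (fun x => (u x * v x)%:E).
  move=> mu mv; apply/measurable_EFinP; apply: measurable_funTS.
  by apply: measurable_funM => //; exact: adapted_measurable.
have posE (p q : R) : Num.max (p * q) 0 =
    Num.max p 0 * Num.max q 0 + Num.max (- p) 0 * Num.max (- q) 0.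
  have /orP[p0|p0] := le_total 0 p; have /orP[q0|q0] := le_total 0 q.
  - rewrite [Num.max (- p) 0]max_r ?oppr_le0// mul0r addr0.
    by rewrite !max_l ?mulr_ge0.
  - rewrite [Num.max q 0]max_r// [Num.max (- p) 0]max_r ?oppr_le0//.
    by rewrite mulr0 mul0r addr0 max_r// mulr_ge0_le0.
  - rewrite [Num.max p 0]max_r// [Num.max (- q) 0]max_r ?oppr_le0//.
    by rewrite mulr0 mul0r addr0 max_r// mulr_le0_ge0.
  - rewrite [Num.max p 0]max_r// mul0r add0r.
    by rewrite !max_l ?mulrNN// ?oppr_ge0// mulr_le0.
have sumE (u v u' v' : T -> R) : measurable_fun setT (u : TG -> R) ->
    measurable_fun setT v -> measurable_fun setT (u' : TG -> R) ->
    measurable_fun setT v' -> (forall x, 0 <= u x) -> (forall x, 0 <= v x) ->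
    (forall x, 0 <= u' x) -> (forall x, 0 <= v' x) ->
    (\int[P]_(x in A) (u x * v x + u' x * v' x)%:E =
     \int[P]_(x in A) (u x * v x)%:E + \int[P]_(x in A) (u' x * v' x)%:E)%E.
  move=> mu mv mu' mv' u0 v0 u'0 v'0.
  under eq_integral do rewrite EFinD.
  by rewrite ge0_integralD// => [x _||x _|]; rewrite ?lee_fin ?mulr_ge0//; exact: m1.
have fp := integrable_fin_num mA (integrable_funrpos mA iphixi).
have fn := integrable_fin_num mA (integrable_funrneg mA iphixi).
pose pr x := phi x * xi x.
rewrite integralE (funerpos pr) (funerneg pr).
suff E : (\int[P]_(x in A) ((pr^\+)%R x)%:E =
    \int[P]_(x in A) ((pr^\-)%R x)%:E)%E by rewrite E subee.
transitivity (\int[P]_(x in A)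
    (phi^\+ x * xi^\+ x + phi^\- x * xi^\- x)%:E)%E.
  by apply: eq_integral => x _; rewrite /= /funrpos /funrneg /= posE.
transitivity (\int[P]_(x in A)
    (phi^\+ x * xi^\- x + phi^\- x * xi^\+ x)%:E)%E; last first.
  apply: eq_integral => x _; rewrite /= /funrpos /funrneg /=.
  by rewrite -mulrN posE opprK.
by rewrite !sumE//; congr (_ + _)%E; [exact: swap|exact/esym/swap].
Qed.

End SubSigmaAlgebra.

Lemma negligible_small d (T : measurableType d) (R : realType)
    (mu : {measure set T -> \bar R}) (N : set T) :
  (forall e : R, 0 < e -> exists B, [/\ measurable B, N `<=` B &
     (mu B <= e%:E)%E]) -> mu.-negligible N.
Proof.
move=> small; have /choice[B BP] : forall k : nat, exists B,
    [/\ measurable B, N `<=` B & (mu B <= (k.+1%:R^-1)%:E)%E].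
  by move=> k; apply: small; rewrite invr_gt0.
exists (\bigcap_k B k); split.
- by apply: bigcapT_measurable => k; case: (BP k).
- apply/eqP; rewrite eq_le measure_ge0 andbT; apply/lee_addgt0Pr => e e0.
  rewrite add0e; have /cvgrPdist_lt/(_ e e0) := @cvg_harmonic R.
  move=> [k _ /(_ k (leqnn k))]; rewrite /= sub0r normrN ger0_norm// => ke.
  have [mB _ Bk] := BP k; apply: (@le_trans _ _ (mu (B k))).
    apply: le_measure; rewrite ?inE//.
      by apply: bigcapT_measurable => i; case: (BP i).
    by move=> x; apply.
  by apply: le_trans Bk _; rewrite lee_fin ltW.
- by move=> x Nx k _; case: (BP k) => _ + _; apply.
Qed.

(** * Almost supermartingales with drift: maximal inequality and convergence to 0 *)

Section AlmostSupermartingale.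
Context d (T : measurableType d) (R : realType) (P : probability T R).
Variable Gen : nat -> set_system T.
Hypothesis Gen_measurable : forall k, Gen k `<=` measurable.
Hypothesis Gen_mono : forall k, Gen k `<=` Gen k.+1.
Local Notation G k := (<<s Gen k>>).
Local Notation TG k := (g_sigma_algebraType (Gen k)).

Variables (u b : nat -> T -> R) (e c : R^nat) (A0 : set T).
Hypotheses (u_ge0 : forall k x, 0 <= u k x) (b_ge0 : forall k x, 0 <= b k x).
Hypothesis u_adapted : forall k, measurable_fun setT (u k : TG k -> R).
Hypothesis b_measurable : forall k, measurable_fun setT (b k).
Hypotheses (e_ge0 : forall k, 0 <= e k) (c_ge0 : forall k, 0 <= c k).
Hypotheses (e_sum : cvgn (series e)) (c_sum : ~ cvgn (series c)).
Hypothesis A0_adapted : G 0%N A0.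
Hypothesis u0_integrable : (\int[P]_(x in A0) (u 0%N x)%:E < +oo)%E.
(** This is E[u_{k+1} + c_k b_k | G_k] <= (1 + e_k) u_k + e_k, integrated over events. The same [e]
    is both factor and additive error, so without drift the recursion is multiplicative in
    [1 + u]. *)
Hypothesis u_step : forall k A, G k A -> A `<=` A0 ->
  (\int[P]_(x in A) (u k x)%:E < +oo ->
   \int[P]_(x in A) (u k.+1 x)%:E + (c k)%:E * \int[P]_(x in A) (b k x)%:E <=
   (1 + e k)%:E * \int[P]_(x in A) (u k x)%:E + (e k)%:E * P A)%E.

Let mG k A : G k A -> measurable A.
Proof. exact: gen_measurable. Qed.

Let mu k : measurable_fun setT (u k).
Proof. exact: (adapted_measurable (Gen_measurable (k := k))). Qed.

Let G_mono k : G k `<=` G k.+1.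
Proof. exact: sub_sigma_algebra2. Qed.

Let G_A0 k : G k A0.
Proof. by elim: k => // k; exact: G_mono. Qed.

Let GI k A B : G k A -> G k B -> G k (A `&` B).
Proof. exact: (@measurableI _ (TG k)). Qed.

Let u_integrable k A : G k A -> A `<=` A0 ->
  (\int[P]_(x in A) (u k x)%:E < +oo)%E.
Proof.
have sub j B : measurable B -> B `<=` A0 ->
    (\int[P]_(x in A0) (u j x)%:E < +oo ->
     \int[P]_(x in B) (u j x)%:E < +oo)%E.
  move=> mB BA; apply: le_lt_trans; apply: ge0_subset_integral => //.
  - exact: (mG (@G_A0 0%N)).
  - by apply/measurable_EFinP; exact: measurable_funTS.
  - by move=> x _; rewrite lee_fin.
move=> GA AA0; apply: sub => //; first exact: mG GA.
elim: k {A GA AA0} => // k IH.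
have := u_step (@G_A0 k) (@subset_refl _ A0) IH.
move=> h; apply: (@le_lt_trans _ _ _ _ _ (le_trans _ h)).
  rewrite leeDl// mule_ge0 ?lee_fin// integral_ge0// => x _.
  by rewrite lee_fin.
rewrite lte_add_pinfty ?lte_mul_pinfty ?lee_fin ?addr_ge0//.
by rewrite (le_lt_trans (probability_le1 P (mG (@G_A0 k))))// ltry.
Qed.

(* The exponential of the tail sum of [e] absorbs the factors [1 + e k]; it
   decreases to 1. *)
Let q k := expR (limn (series e) - series e k).

Let q_ge1 k : 1 <= q k.
Proof.
rewrite -expR0 ler_expR subr_ge0; apply: nondecreasing_cvgn_le => //.
exact: nondecreasing_series.
Qed.

Let q_step k : q k.+1 * (1 + e k) <= q k.
Proof.
have -> : q k = q k.+1 * expR (e k).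
  by rewrite /q -expRD seriesSr; congr expR; ring.
by rewrite ler_wpM2l ?expR_ge0// expR_ge1Dx.
Qed.

Let cvg_q : q k @[k --> \oo] --> (1 : R).
Proof.
have h : limn (series e) - series e k @[k --> \oo] --> (0 : R).
  by rewrite -(subrr (limn (series e))); apply: cvgB => //; exact: cvg_cst.
rewrite -expR0; apply: (cvg_comp _ _ h); exact: continuous_expR.
Qed.

(** This is [q k * (1 + u k x) - 1]. The factor [q k] turns [1 + u] into a supermartingale, and
    subtracting 1 keeps [W] small where [u] is small and [q k] is close to 1. *)
Let W k x := q k * u k x + (q k - 1).

Let W_ge k x : u k x <= W k x.
Proof.
by rewrite /W -[leLHS]mul1r ler_wpDr ?subr_ge0// ler_wpM2r.
Qed.

Let W_ge0 k x : 0 <= W k x.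
Proof. exact: le_trans (W_ge k x). Qed.

Let mW k : measurable_fun setT (W k).
Proof. by apply: measurable_funD => //; exact: measurable_funM. Qed.

Let integral_W k A : measurable A -> (\int[P]_(x in A) (W k x)%:E =
  (q k)%:E * \int[P]_(x in A) (u k x)%:E + (q k - 1)%:E * P A)%E.
Proof.
move=> mA; under eq_integral do rewrite EFinD EFinM.
rewrite ge0_integralD//.
- rewrite ge0_integralZl// ?integral_cst//.
  + by apply/measurable_EFinP; exact: measurable_funTS.
  + by move=> x _; rewrite lee_fin.
  + by rewrite lee_fin expR_ge0.
- by move=> x _; rewrite -EFinM lee_fin mulr_ge0 ?expR_ge0.
- under eq_fun do rewrite -EFinM.
  by apply/measurable_EFinP; apply: measurable_funTS; exact: measurable_funM.
- by move=> x _; rewrite lee_fin subr_ge0.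
Qed.

Let W_step k A : G k A -> A `<=` A0 ->
  (\int[P]_(x in A) (W k.+1 x)%:E + (c k)%:E * \int[P]_(x in A) (b k x)%:E <=
   \int[P]_(x in A) (W k x)%:E)%E.
Proof.
move=> GA AA0; have mA := mG GA; rewrite !integral_W//.
have uk := u_integrable GA AA0.
have uk1 := u_integrable (G_mono GA) AA0.
have m0 j : (0 <= \int[P]_(x in A) (u j x)%:E)%E.
  by apply: integral_ge0 => x _; rewrite lee_fin.
have mfin j : (\int[P]_(x in A) (u j x)%:E < +oo)%E ->
    (\int[P]_(x in A) (u j x)%:E)%E \is a fin_num by rewrite ge0_fin_numE.
have pfin : P A \is a fin_num by exact: fin_num_measure.
have p0 : 0 <= fine (P A) by rewrite fine_ge0.
have := u_step GA AA0 uk.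
have g0 : (0 <= (c k)%:E * \int[P]_(x in A) (b k x)%:E)%E.
  by rewrite mule_ge0 ?lee_fin// integral_ge0// => x _; rewrite lee_fin.
move: (m0 k) (m0 k.+1) g0.
rewrite -(fineK (mfin _ uk)) -(fineK (mfin _ uk1)) -(fineK pfin).
(* [b k] is not assumed integrable, but an infinite drift term would contradict the finite
   right-hand side of [u_step]. *)
case: ((c k)%:E * _)%E => [g||//]; last by rewrite addey// -!EFinM -EFinD.
set m := fine _; set m' := fine _.
rewrite -?EFinM -?EFinD -?EFinM -?EFinD !lee_fin => m_ge0 m'_ge0 g_ge0 ineq.
have := q_ge1 k.+1; have := ler_wpM2r (addr_ge0 m_ge0 p0) (q_step k).
have := ler_wpM2l (le_trans ler01 (q_ge1 k.+1)) ineq.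
have := ler_wpM2r g_ge0 (q_ge1 k.+1).
move: (q k) (q k.+1) => Q Q1; lra.
Qed.

Let level l k := [set x | (l <= u k x)%R].

Let G_level l k : G k (level l k).
Proof.
have -> : level l k = [set: TG k] `&` u k @^-1` `[l, +oo[%classic.
  by rewrite setTI; apply/seteqP; split=> x; rewrite /level/= in_itv/= andbT.
by have := @u_adapted k measurableT _ (measurable_itv `[l, +oo[).
Qed.

Let G_levelC l k : G k (~` level l k).
Proof. by apply: (@measurableC _ (TG k)); exact: G_level. Qed.

Let W_setU k A B : measurable A -> measurable B -> [disjoint A & B] ->
  (\int[P]_(x in A `|` B) (W k x)%:E =
   \int[P]_(x in A) (W k x)%:E + \int[P]_(x in B) (W k x)%:E)%E.
Proof.
move=> mA mB AB; apply: ge0_integral_setU => //; last first.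
  by move=> x _; rewrite lee_fin.
by apply/measurable_EFinP; exact: measurable_funTS.
Qed.

Let markov_level l k A : 0 < l -> G k A ->
  (l%:E * P (A `&` level l k) <= \int[P]_(x in A `&` level l k) (W k x)%:E)%E.
Proof.
move=> l0 GA; have mA := mG (GI GA (@G_level l k)).
rewrite -integral_cst//; apply: ge0_le_integral => //.
- by move=> x _; rewrite lee_fin ltW.
- by apply/measurable_EFinP; exact: measurable_funTS.
- by move=> x [_ lx]; rewrite lee_fin (le_trans _ (W_ge k x)).
Qed.

Let hit l k N := \bigcup_(j in `I_N) level l (k + j).

Let measurable_hit l k N : measurable (hit l k N).
Proof. by apply: bigcup_measurable => j _; exact: mG (@G_level _ _). Qed.

(** Induction on the horizon replaces stopping times. [A] is split at time [k] by [level l k]: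
    Markov's inequality handles the first piece; on the second the induction restarts at [k.+1], and
    [W_step] brings the integral back to time [k]. *)
Let maximal_fin l N k A : 0 < l -> G k A -> A `<=` A0 ->
  (l%:E * P (A `&` hit l k N) <= \int[P]_(x in A) (W k x)%:E)%E.
Proof.
move=> l0; elim: N k A => [|N IH] k A GA AA0; have mA := mG GA.
  rewrite /hit II0 bigcup_set0 setI0 measure0 mule0.
  by apply: integral_ge0 => x _; rewrite lee_fin.
have GA1 := GI GA (@G_level l k); have GA2 := GI GA (@G_levelC l k).
have -> : (\int[P]_(x in A) (W k x)%:E = \int[P]_(x in A `&` level l k) (W k x)%:E
    + \int[P]_(x in A `&` ~` level l k) (W k x)%:E)%E.
  rewrite -W_setU; [|exact: mG GA1|exact: mG GA2|].
    by rewrite -setIUr setUv setIT.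
  by apply/disj_setPS => x [[_ ?] [_ ?]].
have A2A0 : A `&` ~` level l k `<=` A0 by move=> x [/AA0].
apply: (@le_trans _ _ (l%:E * P (A `&` level l k) +
    l%:E * P (A `&` ~` level l k `&` hit l k.+1 N))%E).
  rewrite -ge0_muleDr ?measure_ge0// lee_wpmul2l ?lee_fin ?(ltW l0)//.
  have mA2 := measurableI _ _ (mG GA2) (@measurable_hit l k.+1 N).
  apply: (@le_trans _ _ (P ((A `&` level l k) `|`
    (A `&` ~` level l k `&` hit l k.+1 N)))); last first.
    by apply: measureU2 => //; exact: mG GA1.
  apply: le_measure; rewrite ?inE.
  - exact: measurableI.
  - by apply: measurableU => //; exact: mG GA1.
  move=> x [Ax [j /= jN lj]]; have [lk|lk] := pselect (level l k x).
    by left.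
  right; split=> //; case: j jN lj => [|j] jN; first by rewrite addn0.
  by rewrite -addSnnS => lj; exists j.
apply: leeD; first exact: markov_level.
apply: le_trans (IH _ _ (@G_mono _ _ GA2) A2A0) _.
apply: le_trans (W_step GA2 A2A0); rewrite leeDl// mule_ge0 ?lee_fin//.
by apply: integral_ge0 => x _; rewrite lee_fin.
Qed.

Let maximal l k A : 0 < l -> G k A -> A `<=` A0 ->
  (l%:E * P (A `&` \bigcup_j level l (k + j)) <=
   \int[P]_(x in A) (W k x)%:E)%E.
Proof.
move=> l0 GA AA0; have mA := mG GA.
have mAh N : measurable (A `&` hit l k N) by exact: measurableI.
have -> : A `&` \bigcup_j level l (k + j) = \bigcup_N (A `&` hit l k N).
  rewrite -setI_bigcupr; congr (_ `&` _); apply/seteqP; split.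
    by move=> x [j _ lj]; exists j.+1 => //; exists j => //=.
  by move=> x [N _ [j _ lj]]; exists j.
have ndAh : nondecreasing_seq (fun N => A `&` hit l k N).
  move=> M N MN; apply/subsetPset => x [Ax [j /= jM lj]]; split=> //.
  by exists j => //=; exact: leq_trans MN.
have cP := nondecreasing_cvg_mu (mu := P) mAh (bigcup_measurable (fun N _ => mAh N)) ndAh.
have fl : l%:E \is a fin_num by [].
have := cvgeZl fl cP; move/cvge_to_le; apply.
by near=> N; exact: maximal_fin.
Unshelve. all: by end_near. Qed.

Let W_integrable k : (\int[P]_(x in A0) (W k x)%:E)%E \is a fin_num.
Proof.
have GA := @G_A0 k; rewrite integral_W; last exact: mG GA.
have uf : (\int[P]_(x in A0) (u k x)%:E)%E \is a fin_num.
  rewrite ge0_fin_numE; first exact: u_integrable GA _.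
  by apply: integral_ge0 => x _; rewrite lee_fin.
have pf : P A0 \is a fin_num by apply: fin_num_measure; exact: mG GA.
by rewrite fin_numD !fin_numM.
Qed.

(** If the drift integral stayed above [r] from [n0] on, telescoping [W_step] would bound [r] times
    the tail of the divergent series of [c] by the integral of [W n0]. *)
Let small_drift r n0 : 0 < r ->
  exists2 n, (n0 <= n)%N & (\int[P]_(x in A0) (b n x)%:E < r%:E)%E.
Proof.
move=> r0; apply: contrapT => noex; apply: c_sum.
have big_b n : (n0 <= n)%N -> (r%:E <= \int[P]_(x in A0) (b n x)%:E)%E.
  by move=> n0n; rewrite leNgt; apply/negP => bn; apply: noex; exists n.
have sumW n : ((r * (series c (n0 + n)%N - series c n0))%:E +
    \int[P]_(x in A0) (W (n0 + n) x)%:E <= \int[P]_(x in A0) (W n0 x)%:E)%E.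
  elim: n => [|n IH]; first by rewrite addn0 subrr mulr0 add0e.
  apply: le_trans IH; rewrite addnS seriesSr addrAC mulrDr EFinD -addeA.
  rewrite leeD2l//; apply: le_trans (W_step (@G_A0 _) (@subset_refl _ A0)).
  rewrite addeC leeD2l// mulrC EFinM lee_wpmul2l ?lee_fin//.
  by rewrite big_b// leq_addr.
have bnd n : series c (n0 + n)%N <=
    series c n0 + fine (\int[P]_(x in A0) (W n0 x)%:E) / r.
  rewrite -lerBlDl ler_pdivlMr// mulrC -lee_fin fineK//.
  apply: le_trans (sumW n); rewrite leeDl// integral_ge0// => x _.
  by rewrite lee_fin.
apply: nondecreasing_is_cvgn; first exact: nondecreasing_series.
exists (series c n0 + fine (\int[P]_(x in A0) (W n0 x)%:E) / r).
move=> _ [n _ <-]; apply: le_trans (bnd n).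
by apply: nondecreasing_series => //; rewrite leq_addl.
Qed.

(** At one late time [n] the drift is small in mean, so on [E] and off a small event [u n] is small;
    the maximal inequality then keeps [u] below any given level. [E] is used only pointwise, so it
    may depend on the whole future. *)
Lemma almost_supermartingale_cvg0 (E : set T) :
  (forall delta, 0 < delta -> exists2 kappa, 0 < kappa &
    forall k x, E x -> delta < u k x -> kappa <= b k x) ->
  P.-negligible [set x | [/\ A0 x, E x & ~ (u k x @[k --> \oo] --> (0 : R))]].
Proof.
move=> drift; pose io l := [set x | [/\ A0 x, E x &
  forall n, exists j, (l <= u (n + j)%N x)%R]].
have : P.-negligible (\bigcup_k io (k.+1%:R^-1)).
  apply: negligible_bigcup => i; set l := _^-1.
  have l0 : 0 < l by rewrite invr_gt0.
  apply: negligible_small => r r0.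
  (* Once [q n <= 2] and [q n - 1 <= r * l / 4], this choice gives [W n x <= r * l / 2] where
     [u n x <= delta], hence probability at most [r / 2] of reaching [l] later. *)
  pose delta := r * l / 8; have delta0 : 0 < delta by rewrite !divr_gt0 ?mulr_gt0.
  have [kappa kappa0 kappaP] := drift _ delta0.
  have /cvgrPdist_lt/(_ (Num.min 1 (r * l / 4))) := cvg_q.
  rewrite lt_min ltr01 !divr_gt0 ?mulr_gt0// => /(_ isT)[n0 _ qn0].
  have [n n0n bn] := small_drift n0 (mulr_gt0 kappa0 (divr_gt0 r0 (ltr0n _ 2))).
  have := qn0 n n0n; rewrite /= lt_min distrC ger0_norm ?subr_ge0// => /andP[q1 q2].
  have GA0 := @G_A0 n.
  pose B1 := A0 `&` [set x | kappa <= b n x].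
  pose A := A0 `&` ~` [set x | delta < u n x].
  have GA : G n A.
    apply: GI => //; apply: (@measurableC _ (TG n)).
    have -> : [set x | delta < u n x] = [set: TG n] `&` u n @^-1` `]delta, +oo[%classic.
      by rewrite setTI; apply/seteqP; split=> x; rewrite /= in_itv/= andbT.
    by have := @u_adapted n measurableT _ (measurable_itv `]delta, +oo[).
  have mA0 := mG GA0; have mA := mG GA.
  have mB1 : measurable B1.
    apply: measurableI => //.
    have -> : [set x | kappa <= b n x] = [set: T] `&` b n @^-1` `[kappa, +oo[%classic.
      by rewrite setTI; apply/seteqP; split=> x; rewrite /= in_itv/= andbT.
    by have := @b_measurable n measurableT _ (measurable_itv `[kappa, +oo[).
  pose B2 := A `&` \bigcup_j level l (n + j).
  have mB2 : measurable B2.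
    apply: measurableI => //; apply: bigcup_measurable => j _.
    exact: mG (@G_level l _).
  (* On [E], exceeding [delta] at time [n] forces a large drift, that is [B1]; otherwise [u n] is
     small and reaching [l] later is [B2]. *)
  exists (B1 `|` B2); split; first exact: measurableU.
    move=> x [Ax Ex hx]; have [ux|ux] := pselect (delta < u n x).
      by left; split=> //; exact: kappaP.
    by right; split=> //; have [j] := hx n; exists j.
  apply: (@le_trans _ _ (P B1 + P B2)%E); first exact: measureU2.
  rewrite (splitr r) EFinD; apply: leeD.
    rewrite -(@lee_pmul2l _ kappa%:E)// ?lte_fin// -EFinM.
    apply: le_trans (ltW bn); rewrite -integral_cst//.
    apply: (@le_trans _ _ (\int[P]_(x in B1) (b n x)%:E)%E).
      apply: ge0_le_integral => //.
      - by move=> x _; rewrite lee_fin ltW.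
      - by apply/measurable_EFinP; exact: measurable_funTS.
      - by move=> x [].
    apply: ge0_subset_integral => //.
    - by apply/measurable_EFinP; exact: measurable_funTS.
    - by move=> x _; rewrite lee_fin.
    - by move=> x [].
  rewrite -(@lee_pmul2l _ l%:E)// ?lte_fin// -EFinM.
  apply: (le_trans (maximal l0 GA (@subIsetl _ _ _))).
  apply: (@le_trans _ _ (\int[P]_(x in A) (l * (r / 2))%:E)%E).
    apply: ge0_le_integral => //.
    - by move=> x _; rewrite lee_fin.
    - by apply/measurable_EFinP; exact: measurable_funTS.
    - move=> x [_ /negP]; rewrite -leNgt lee_fin /W => ux.
      have : q n * u n x <= 2 * delta by apply: ler_pM => //; rewrite ?expR_ge0//; lra.
      by rewrite /delta; lra.
  rewrite integral_cst// -[leRHS]mule1 lee_wpmul2l ?lee_fin//.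
    by rewrite mulr_ge0 ?divr_ge0// ltW.
  exact: probability_le1.
(* A nonnegative sequence that does not tend to 0 reaches some level [i.+1%:R^-1] infinitely
   often. *)
apply: negligibleS => x [Ax Ex ux0].
apply: contrapT => noio; apply: ux0; apply/cvgrPdist_le => r r0.
have /cvgrPdist_lt/(_ r r0)[i _ /(_ i (leqnn i))] := @cvg_harmonic R.
rewrite /= sub0r normrN ger0_norm// => ir.
have [n hn] : exists n, forall j, u (n + j)%N x < i.+1%:R^-1.
  apply: contrapT => nohn; apply: noio; exists i => //; split => // n.
  apply: contrapT => nohj; apply: nohn; exists n => j.
  by rewrite ltNge; apply/negP => uj; apply: nohj; exists j.
exists n => // k /= nk; rewrite sub0r normrN ger0_norm//.
by rewrite -(subnKC nk) (le_trans _ (ltW ir))// ltW.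
Qed.

End AlmostSupermartingale.

(** * Inequalities between conditional expectations *)

Section ConditionalBounds.
Context d (T : measurableType d) (R : realType) (P : probability T R).
Variable Gen : set_system T.
Hypothesis Gen_measurable : Gen `<=` measurable.
Local Notation G := <<s Gen>>.

(** E[X | G] <= E[Y | G] tested on events: no version has to be chosen, and infinite integrals are
    allowed. *)
Definition cond_le (X Y : T -> R) : Prop := forall A, G A ->
  (\int[P]_(x in A) (X x)%:E <= \int[P]_(x in A) (Y x)%:E)%E.

Lemma cond_exp_measurable (X Y : T -> \bar R) :
  is_cond_exp P G X Y -> measurable_fun setT Y.
Proof.
move=> [mY _] _ B mB; rewrite setTI. exact: (gen_measurable Gen_measurable (mY B mB)).
Qed.

Lemma integral_le_funepos (Y : T -> \bar R) A :
  (\int[P]_(x in A) Y x <= \int[P]_(x in A) Y^\+ x)%E.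
Proof.
rewrite integralE geeDl// oppe_le0; apply: integral_ge0 => x _.
exact: funeneg_ge0.
Qed.

Lemma cond_exp_le (X f : T -> R) (Y : T -> \bar R) :
  is_cond_exp P G (EFin \o X) Y -> measurable_fun setT f ->
  (forall x, 0 <= f x) -> {ae P, forall x, (Y x <= (f x)%:E)%E} ->
  cond_le X f.
Proof.
move=> XY mf f0 Yf A GA; have mA := gen_measurable Gen_measurable GA.
have mY := cond_exp_measurable XY.
case: XY => _ XY; have := XY A GA; rewrite /= => <-.
(* A version [Y] need not be pointwise nonnegative. Its positive part is, and stays almost surely
   below [f] since [f] is nonnegative. *)
apply: le_trans (integral_le_funepos _ _) _.
apply: ae_ge0_le_integral => //.
- by apply: measurable_funTS; exact: measurable_funepos.
- by move=> x _; rewrite lee_fin.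
- by apply/measurable_EFinP; exact: measurable_funTS.
- apply: filterS Yf => x Yx _; rewrite funeposE ge_max Yx lee_fin.
  exact: f0.
Qed.

Lemma cond_exp_le_cond_exp (c : R) (X Z : T -> R) (Y D : T -> \bar R) :
  0 <= c -> measurable_fun setT Z -> (forall x, 0 <= Z x) ->
  is_cond_exp P G (EFin \o X) Y -> is_cond_exp P G (EFin \o Z) D ->
  {ae P, forall x, (Y x <= c%:E * (1 + D x))%E} ->
  cond_le X (fun x => c * (1 + Z x)).
Proof.
move=> c0 mZ Z0 XY ZD YD A GA; have mA := gen_measurable Gen_measurable GA.
have mY := cond_exp_measurable XY; have mD := cond_exp_measurable ZD.
case: XY => _ /(_ A GA) /= <-; apply: le_trans (integral_le_funepos _ _) _.
have mDp := measurable_funTS (measurable_funepos mD) (D := A).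
apply: (@le_trans _ _ (\int[P]_(x in A) (c%:E * (1 + D^\+ x)))%E).
  apply: ae_ge0_le_integral => //.
  - by apply: measurable_funTS; exact: measurable_funepos.
  - by move=> x _; rewrite mule_ge0 ?lee_fin// adde_ge0.
  - by apply: measurable_funeM; exact: emeasurable_funD.
  - apply: filterS YD => x Yx _; rewrite funeposE ge_max; apply/andP; split.
      apply: le_trans Yx _; rewrite lee_wpmul2l ?lee_fin// leeD2l//.
      by rewrite funeposE le_max lexx.
    by rewrite mule_ge0 ?lee_fin// adde_ge0.
rewrite ge0_integralZl//; last 2 first.
- exact: emeasurable_funD.
- by move=> x _; rewrite adde_ge0.
under [leRHS]eq_integral do rewrite EFinM EFinD.
have mZA : measurable_fun A (fun x => (Z x)%:E).
  by apply/measurable_EFinP; exact: measurable_funTS.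
rewrite [leRHS]ge0_integralZl//; last 2 first.
- exact: emeasurable_funD.
- by move=> x _; rewrite adde_ge0// lee_fin.
rewrite lee_wpmul2l ?lee_fin// !ge0_integralD//; last first.
  by move=> x _; rewrite lee_fin.
rewrite leeD2l//.
(* [D] is [G]-measurable, so this is an event of [G]; the integral of [D^\+] over [A] is that of [D]
   over [A] intersected with it, hence that of [Z]. *)
pose Dge0 := [set x | (0 <= D x)%E].
have GA' : G (A `&` Dge0).
  apply: (@measurableI _ (g_sigma_algebraType Gen)) => //.
  have -> : Dge0 = D @^-1` `[0%E, +oo%E]%classic.
    by apply/seteqP; split=> x; rewrite /Dge0/= in_itv/= leey andbT.
  by case: ZD => GD _; apply: GD; exact: emeasurable_itv.
have -> : (\int[P]_(x in A) D^\+ x = \int[P]_(x in A `&` Dge0) D x)%E.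
  rewrite integral_mkcondr; apply: eq_integral => x _; rewrite patchE.
  rewrite funeposE; case: ifPn; first by move/set_mem => /max_idPl.
  by move=> /negP; rewrite inE /Dge0/= => /negP; rewrite -ltNge => /ltW/max_idPr.
case: ZD => _ /(_ _ GA') /= ->; apply: ge0_subset_integral => //.
- exact: (gen_measurable Gen_measurable GA').
- by move=> x _; rewrite lee_fin.
Qed.

(** One summand of a pointwise bound is exchanged for its conditional majorant; this serves to
    eliminate noise terms one at a time. *)
Lemma cond_le_trans_affine (a : R) (X U U' Y : T -> R) :
  0 <= a -> (forall x, 0 <= X x) -> (forall x, 0 <= U x) ->
  (forall x, 0 <= U' x) -> (forall x, 0 <= Y x) ->
  measurable_fun setT X -> measurable_fun setT U -> measurable_fun setT U' ->
  measurable_fun setT Y -> (forall x, X x <= a * U x + Y x) ->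
  cond_le U U' -> cond_le X (fun x => a * U' x + Y x).
Proof.
move=> a0 X0 U0 U'0 Y0 mX mU mU' mY XU UU' A GA.
have mA := gen_measurable Gen_measurable GA.
have mE (f : T -> R) : measurable_fun setT f ->
    measurable_fun A (fun x => (f x)%:E).
  by move=> mf; apply/measurable_EFinP; exact: measurable_funTS.
have affineE (f : T -> R) : measurable_fun setT f -> (forall x, 0 <= f x) ->
    (\int[P]_(x in A) (a * f x + Y x)%:E =
     a%:E * \int[P]_(x in A) (f x)%:E + \int[P]_(x in A) (Y x)%:E)%E.
  move=> mf f0; under eq_integral do rewrite EFinD EFinM.
  rewrite ge0_integralD//; first rewrite ge0_integralZl ?lee_fin//.
  - exact: mE.
  - by move=> x _; rewrite lee_fin.
  - by move=> x _; rewrite -EFinM lee_fin mulr_ge0.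
  - by apply: measurable_funeM; exact: mE.
  - by move=> x _; rewrite lee_fin.
  - exact: mE.
rewrite affineE//; apply: (@le_trans _ _ (\int[P]_(x in A) (a * U x + Y x)%:E)%E).
  apply: ge0_le_integral => //; try exact: mE.
  - by move=> x _; rewrite lee_fin.
  - by apply: mE; apply: measurable_funD => //; exact: measurable_funM.
  - by move=> x _; rewrite lee_fin.
by rewrite affineE// leeD2r// lee_wpmul2l ?lee_fin// UU'.
Qed.

End ConditionalBounds.

(** * The pathwise one-step inequality *)

Section OneStep.
Context {R : realType} {n : nat}.

(* With B = (eta V)^2, the factor 1 + 4 B absorbs both the cost B |z|^2 of using
   the same sample twice and the random terms it multiplies. *)
Lemma extragradient_step (z h1 h2 H : 'rV[R]_n) (eta V L K : R) :
  0 < eta -> 0 < V -> 0 < K -> eta * K <= 1 / 4 ->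
  dotv (h2 - h1) (h2 - h1) <= (L * V) ^+ 2 * (eta ^+ 2 * dotv h1 h1) ->
  dotv H H <= K ^+ 2 * dotv z z ->
  dotv (z - eta *: h2) (z - eta *: h2) <= (1 + 4 * (eta * V) ^+ 2) *
    (dotv z z - 2 * eta * dotv H z + 2 * eta * dotv (H - h1) z +
     eta ^+ 2 * (L ^+ 2 * dotv h1 h1 + dotv h2 h2 +
       4 * dotv (H - h1) (H - h1))).
Proof.
move=> eta0 V0 K0 etaK hL hK.
set B := (eta * V) ^+ 2; have B0 : 0 < B by rewrite exprn_gt0// mulr_gt0.
set r2 := dotv z z; set g := dotv H z; set s := dotv (H - h1) z.
set x := dotv (H - h1) (H - h1); set a := dotv h1 h1; set b := dotv h2 h2.
rewrite -/a in hL; rewrite -/r2 in hK.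
have r20 : 0 <= r2 := dotvv_ge0 z; have x0 : 0 <= x := dotvv_ge0 _.
have a0 : 0 <= a := dotvv_ge0 _; have b0 : 0 <= b := dotvv_ge0 _.
have h2z : dotv h2 z = g - s + dotv (h2 - h1) z.
  by rewrite /g /s !(dotvDl, dotvNl); ring.
have -> : dotv (z - eta *: h2) (z - eta *: h2) =
    r2 - 2 * eta * (g - s + dotv (h2 - h1) z) + eta ^+ 2 * b.
  rewrite -h2z dotvDl !dotvDr !dotvNl !dotvNr !dotvZl !dotvZr (dotvC z h2).
  by rewrite /r2 /b; ring.
(* The weight [(eta * V ^+ 2)^-1] cancels the [V ^+ 2] of the Lipschitz bound and leaves [V] only in
   front of [r2]. *)
have young1 : - (2 * eta * dotv (h2 - h1) z) <= eta ^+ 2 * L ^+ 2 * a + B * r2.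
  have t0 : 0 < (eta * V ^+ 2)^-1 by rewrite invr_gt0 mulr_gt0 ?exprn_gt0.
  have := dotv_young (- (h2 - h1)) z t0.
  rewrite !dotvNl dotvNr opprK invrK => Y1.
  have : (eta * V ^+ 2)^-1 * dotv (h2 - h1) (h2 - h1) <= eta * L ^+ 2 * a.
    rewrite mulrC ler_pdivrMr ?mulr_gt0 ?exprn_gt0//.
    by apply: le_trans hL _; rewrite le_eqVlt; apply/orP; left; apply/eqP; ring.
  have -> : B = eta * (eta * V ^+ 2) by rewrite /B; ring.
  move=> Y2; have : eta * (2 * - dotv (h2 - h1) z) <=
      eta * (eta * L ^+ 2 * a + eta * V ^+ 2 * r2).
    by rewrite ler_wpM2l ?(ltW eta0)// (le_trans Y1)// lerD2r.
  move=> Y3; apply: le_trans (_ : _ <= eta * (2 * - dotv (h2 - h1) z)) _.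
    by rewrite le_eqVlt; apply/orP; left; apply/eqP; ring.
  by apply: le_trans Y3 _; rewrite le_eqVlt; apply/orP; left; apply/eqP; ring.
(* The noise cross term is charged to a quarter of [r2]; the next bound charges the drift to half of
   it, using [eta * K <= 1 / 4]. *)
have young2 : - (2 * eta * s) <= r2 / 4 + 4 * eta ^+ 2 * x.
  have t0 : 0 < 4 * eta by rewrite mulr_gt0.
  have := dotv_young (- (H - h1)) z t0.
  rewrite !dotvNl dotvNr opprK -/s -/x -/r2 => Y1.
  have := ler_wpM2l (ltW eta0) Y1.
  have -> : eta * (4 * eta * x + (4 * eta)^-1 * r2) = 4 * eta ^+ 2 * x + r2 / 4.
    by field; rewrite gt_eqF.
  have -> : eta * (2 * - s) = - (2 * eta * s) by ring.
  by move=> Y2; rewrite addrC.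
have young3 : 2 * eta * g <= r2 / 2.
  have Ki : 0 < K^-1 by rewrite invr_gt0.
  have := dotv_young H z Ki; rewrite invrK -/g -/r2 => Y1.
  have Y2 : K^-1 * dotv H H <= K * r2.
    by rewrite ler_pdivrMl// mulrA -expr2.
  have Y3 : eta * (2 * g) <= eta * (2 * (K * r2)).
    by rewrite ler_wpM2l ?(ltW eta0)//; lra.
  have := ler_wpM2r r20 etaK; rewrite mulrCA mulrA in Y3.
  by move: Y3; rewrite !mulrA; lra.
(* At least a quarter of [r2] survives in the bracket, so [4 * B] times the bracket pays for
   [B * r2]. This is the origin of the 4. *)
have : B * r2 <= 4 * B * (r2 - 2 * eta * g + 2 * eta * s +
    eta ^+ 2 * (L ^+ 2 * a + b + 4 * x)).
  have e2 : 0 <= eta ^+ 2 by exact: sqr_ge0.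
  have : 0 <= eta ^+ 2 * (L ^+ 2 * a) by rewrite mulr_ge0// mulr_ge0// sqr_ge0.
  have : 0 <= eta ^+ 2 * b by rewrite mulr_ge0.
  move=> h3 h4; rewrite -mulrA [leRHS]mulrCA ler_wpM2l ?(ltW B0)//.
  lra.
have e2x : 0 <= eta ^+ 2 * x by rewrite mulr_ge0// sqr_ge0.
by rewrite mulrDl mul1r; lra.
Qed.

End OneStep.

(** * Step sizes and averages *)

Section StepSizes.
Context {R : realType}.

(* The increment of [- x `^ (- b) / b] over [[n + 1, n + 2]] dominates the next
   term of the series. *)
Lemma riemannR_le_telescope (b : R) n : 0 < b ->
  b * riemannR (b + 1) n.+1 <= n.+1%:R `^ (- b) - n.+2%:R `^ (- b).
Proof.
move=> b0; set x : R := n.+1%:R; set y : R := n.+2%:R.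
have x0 : 0 < x by []. have y0 : 0 < y by [].
have yx : y = x + 1 by rewrite /y /x -natr1.
have lnxy : ln x - ln y <= - y^-1.
  rewrite -ln_div ?posrE//; have -> : x / y = 1 + (- y^-1).
    by rewrite yx; field; rewrite gt_eqF// -yx.
  apply: le_ln1Dx; rewrite ltrN2 invf_lt1// /y ltr1n//.
have -> : riemannR (b + 1) n.+1 = y `^ (- b) * y^-1.
  rewrite /riemannR -/y powRD; last by rewrite (gt_eqF y0) implybT.
  by rewrite powRr1 ?(ltW y0)// invfM powRN.
have -> : x `^ (- b) = y `^ (- b) * expR (b * (ln y - ln x)).
  by rewrite /powR !gt_eqF// -expRD; congr expR; ring.
rewrite -[X in _ - X]mulr1 -mulrBr mulrCA ler_wpM2l ?powR_ge0//.
have := expR_ge1Dx (b * (ln y - ln x)).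
have : b * y^-1 <= b * (ln y - ln x) by rewrite ler_wpM2l ?(ltW b0)//; rewrite -lerN2 opprB.
by move=> h1 h2; apply: le_trans h1 _; rewrite lerBrDl.
Qed.

(** Summing the telescoping bound with [b = s - 1] keeps the partial sums below [1 + b^-1]. *)
Lemma cvg_riemannR (s : R) : 1 < s -> cvgn (series (riemannR s)).
Proof.
move=> s1; pose b := s - 1; have b0 : 0 < b by rewrite subr_gt0.
have sE : s = b + 1 by rewrite /b subrK.
have s0 : 0 <= s by rewrite ltW// (lt_trans ltr01).
apply: nondecreasing_is_cvgn.
  by apply: nondecreasing_series => k _ _; rewrite ltW//; exact: riemannR_gt0.
have bnd k : series (riemannR s) k.+1 <= 1 + b^-1 * (1 - k.+1%:R `^ (- b)).
  elim: k => [|k IH].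
    rewrite seriesSr /series /= big_geq// add0r /riemannR !mulr1n !powR1.
    by rewrite invr1 subrr mulr0 addr0.
  rewrite seriesSr; apply: le_trans (lerD IH (lexx _)) _.
  rewrite -addrA lerD2l -lerBrDl -mulrBr.
  rewrite -(ler_pM2l b0) mulrA divff ?gt_eqF// mul1r sE.
  by apply: le_trans (riemannR_le_telescope k b0) _; lra.
exists (1 + b^-1) => _ [k _ <-].
apply: (@le_trans _ _ (series (riemannR s) k.+1)).
  by rewrite seriesSr lerDl ltW// riemannR_gt0.
apply: le_trans (bnd k) _; rewrite lerD2l -[leRHS]mulr1 ler_wpM2l ?invr_ge0 ?(ltW b0)//.
Qed.

Lemma poly_step_riemannR (eta a : R) k :
  poly_step eta a k.+1 = eta * riemannR a k.
Proof. by rewrite /poly_step powRN. Qed.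

Lemma poly_step_sqr (eta a : R) k :
  poly_step eta a k.+1 ^+ 2 = eta ^+ 2 * riemannR (2 * a) k.
Proof.
rewrite poly_step_riemannR exprMn /=; congr (_ * _).
by rewrite exprVn -powR_mulrn ?powR_ge0// -powRrM mulrC.
Qed.

Lemma poly_step_gt0 (eta a : R) k : 0 < eta -> 0 < poly_step eta a k.+1.
Proof. by move=> eta0; rewrite mulr_gt0// powR_gt0. Qed.

Lemma poly_step_le (eta a : R) k : 0 < eta -> 0 <= a ->
  poly_step eta a k.+1 <= eta.
Proof.
move=> eta0 a0; rewrite ler_piMr ?(ltW eta0)// powRN invf_le1 ?powR_gt0//.
by rewrite -[leLHS](powRr0 k.+1%:R) ler_powR// ler1n.
Qed.

Lemma cvg_series_scale (c : R) (u : R^nat) : cvgn (series u) ->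
  cvgn (series (fun k => c * u k)).
Proof. by move=> cu; exact: is_cvg_seriesZ. Qed.

Lemma poly_step_series (eta a : R) : 0 < eta -> 1 / 2 < a < 1 ->
  ~ cvgn (series (fun k => 2 * poly_step eta a k.+1)) /\
  cvgn (series (fun k => poly_step eta a k.+1 ^+ 2)).
Proof.
move=> eta0 /andP[a2 a1]; split; last first.
  under eq_fun do rewrite poly_step_sqr.
  by apply: cvg_series_scale; apply: cvg_riemannR; lra.
move=> /(@cvg_series_scale (2 * eta)^-1).
rewrite (_ : (fun k => _) = riemannR a).
  by apply: dvg_riemannR; lra.
apply/funext => k; rewrite poly_step_riemannR; field.
by rewrite gt_eqF.
Qed.

End StepSizes.

(** Cesaro's theorem for the norms of [u k.+1 - l]. The shift reconciles an average starting at
    index 1 with a mean starting at 0. *)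
Lemma cvg_average (R : realType) n (u : nat -> 'rV[R]_n) (l : 'rV[R]_n) :
  u k @[k --> \oo] --> l ->
  k%:R^-1 *: \sum_(1 <= i < k.+1) u i @[k --> \oo] --> l.
Proof.
move=> ul; pose v k := `|u k.+1 - l|.
have v0 : v k @[k --> \oo] --> (0 : R).
  apply/cvgrPdist_le => e e0; have : u k.+1 @[k --> \oo] --> l.
    by have := ul; rewrite -(cvg_shiftS u).
  move=> /cvgrPdist_le/(_ e e0); apply: filterS => k.
  by rewrite /v sub0r normrN normr_id distrC.
have := cesaro v0 => /cvgrPdist_le mv0.
suff : k.+1%:R^-1 *: \sum_(1 <= i < k.+2) u i @[k --> \oo] --> l.
  by rewrite -(cvg_shiftS (fun k => k%:R^-1 *: \sum_(1 <= i < k.+1) u i)).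
apply/cvgrPdist_le => e e0; apply: filterS (mv0 e e0) => k.
rewrite sub0r normrN; apply: le_trans.
have -> : l - k.+1%:R^-1 *: \sum_(1 <= i < k.+2) u i =
    - (k.+1%:R^-1 *: \sum_(0 <= i < k.+1) (u i.+1 - l)).
  rewrite sumrB big_const_nat iter_addr_0 subn0 big_add1 /= scalerBr.
  by rewrite opprB -[l *+ _]scaler_nat scalerA mulVf ?scale1r// pnatr_eq0.
rewrite normrN normrZ gtr0_norm ?invr_gt0// ger0_norm.
  rewrite /arithmetic_mean ler_wpM2l ?invr_ge0//; exact: ler_norm_sum.
rewrite /arithmetic_mean mulr_ge0 ?invr_ge0//; apply: sumr_ge0 => i _.
exact: normr_ge0.
Qed.

Lemma nneseries_fin (R : realType) (u : R^nat) : (forall k, 0 <= u k) ->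
  cvgn (series u) -> (\sum_(0 <= k <oo) (u k)%:E < +oo)%E.
Proof.
move=> u0 cu; rewrite (_ : (\sum_(0 <= k <oo) _)%E = (limn (series u))%:E) ?ltry//.
rewrite -EFin_lim//; congr (limn _); apply/funext => k /=.
by rewrite sumEFin.
Qed.

(** * Measurability through coordinates *)

Section MeasurableCoordinates.
Context d (T : measurableType d) (R : realType) (n : nat).
Implicit Types X Y : T -> 'rV[R]_n.

Definition coord_measurable X := forall i, measurable_fun setT (fun t => X t 0 i).

Lemma coord_measurableB X Y : coord_measurable X -> coord_measurable Y ->
  coord_measurable (fun t => X t - Y t).
Proof.
move=> mX mY i; under eq_fun do rewrite !mxE; exact: measurable_funB.
Qed.

Lemma coord_measurableZ (a : R) X : coord_measurable X ->
  coord_measurable (fun t => a *: X t).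
Proof.
by move=> mX i; under eq_fun do rewrite !mxE; exact: measurable_funM.
Qed.

Lemma coord_measurable_cst (v : 'rV[R]_n) : coord_measurable (fun=> v).
Proof. by move=> i; exact: measurable_cst. Qed.

Lemma measurable_dotv X Y : coord_measurable X -> coord_measurable Y ->
  measurable_fun setT (fun t => dotv (X t) (Y t)).
Proof.
by move=> mX mY; apply: measurable_sum => i; exact: measurable_funM.
Qed.

End MeasurableCoordinates.

Ltac nonneg := repeat first [by [] | exact: sqr_ge0 | exact: dotvv_ge0 |
  apply: addr_ge0 | apply: mulr_ge0].

(** * The scaled error of the extra-gradient iterates *)

Section ExtraGradient.
Context {R : realType} {dt dm : nat}.
Local Notation vec := 'rV[R]_(dt + dm).
Local Notation bvec := (borel_rV R (dt + dm)).
Context d (Omega : measurableType d) (P : probability Omega R).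
Variables (H : vec -> vec) (Hn : vec -> vec -> vec) (zs : vec) (V : bvec -> R).
Variables (L K C : R) (step : nat -> R).
Variables (z0 : Omega -> bvec) (w : nat -> Omega -> bvec).

Hypothesis H_continuous : forall i, continuous (fun z => H z 0 i).
Hypothesis H_growth : forall z,
  dotv (H z) (H z) <= K ^+ 2 * dotv (z - zs) (z - zs).
Hypothesis H_monotone : forall z, 0 <= dotv (H z) (z - zs).
Hypothesis Hn_measurable : forall z i,
  measurable_fun setT (fun u : bvec => Hn z u 0 i).
Hypothesis Hn_continuous : forall u i, continuous (fun z => Hn z u 0 i).
Hypothesis Hn_lipschitz : forall u z1 z2,
  dotv (Hn z1 u - Hn z2 u) (Hn z1 u - Hn z2 u) <=
  (L * V u) ^+ 2 * dotv (z1 - z2) (z1 - z2).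
Hypotheses (V_measurable : measurable_fun setT V) (V_gt0 : forall u, 0 < V u).
Hypotheses (K_gt0 : 0 < K) (C_gt0 : 0 < C).
Hypothesis step_gt0 : forall k, 0 < step k.+1.
Hypothesis step_le1 : forall k, step k.+1 <= 1.
Hypothesis step_small : forall k, step k.+1 * K <= 1 / 4.
Hypothesis z0_measurable : measurable_fun setT z0.
Hypothesis w_measurable : forall k, measurable_fun setT (w k.+1).

Local Notation z := (seg Hn step z0 w).
Local Notation zh := (seg_half Hn step z0 w).
Local Notation xi := (fun z u => H z - Hn z u).
Local Notation G := (seg_filtration Hn step z0 w).

Hypothesis A3 : assumptionA3 P xi zs G z zh w C.

Lemma coord_measurable_field (X : Omega -> bvec) k : measurable_fun setT X ->
  coord_measurable (fun x => Hn (X x) (w k.+1 x)).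
Proof.
move=> mX i; have := @measurable_caratheodory R _ _ _ Omega bvec
  (fun y u => Hn y u 0 i) X (w k.+1).
by apply.
Qed.

Lemma measurable_half_step k (X : Omega -> bvec) : measurable_fun setT X ->
  measurable_fun setT (fun x => half_step Hn step w k (X x) x : bvec).
Proof.
move=> mX; apply: measurable_rV; apply: coord_measurableB.
  by move=> i; exact: measurable_coord.
by apply: coord_measurableZ; exact: coord_measurable_field.
Qed.

Lemma measurable_seg k : measurable_fun setT (z k : Omega -> bvec).
Proof.
elim: k => //= k IH; apply: measurable_rV; apply: coord_measurableB.
  by move=> i; exact: measurable_coord.
apply: coord_measurableZ; apply: coord_measurable_field.
exact: measurable_half_step.
Qed.

(** Generators of [seg_filtration], named so that [<<s seg_gen k>>] unfolds to it and the results on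
    generated sigma-algebras apply. *)
Definition seg_gen k : set_system Omega :=
  [set A | exists B : set bvec, measurable B /\
     ((exists2 j, (j <= k)%N & A = z j @^-1` B) \/
      (exists2 j, (1 <= j <= k)%N & A = w j @^-1` B))].

Lemma seg_gen_measurable k : seg_gen k `<=` measurable.
Proof.
move=> A [B [mB [[j _ ->]|[[//|j] _ ->]]]]; rewrite -[X in measurable X]setTI.
  exact: measurable_seg.
exact: w_measurable.
Qed.

Lemma seg_gen_mono k : seg_gen k `<=` seg_gen k.+1.
Proof.
move=> A [B [mB [[j jk ->]|[j /andP[j1 jk] ->]]]]; exists B; split=> //.
  by left; exists j => //; exact: leqW.
by right; exists j => //; rewrite j1 leqW.
Qed.

Local Notation TG k := (g_sigma_algebraType (seg_gen k)).

Lemma seg_adapted k : measurable_fun setT (z k : TG k -> bvec).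
Proof.
move=> _ B mB; rewrite setTI; apply: sub_sigma_algebra; exists B; split=> //.
by left; exists k.
Qed.

Lemma sample_adapted k j : (1 <= j <= k)%N ->
  measurable_fun setT (w j : TG k -> bvec).
Proof.
move=> jk _ B mB; rewrite setTI; apply: sub_sigma_algebra; exists B; split=> //.
by right; exists j.
Qed.

Definition err k x := dotv (z k x - zs) (z k x - zs).

Definition amplification j x := (step j * V (w j x)) ^+ 2.

(** Only the samples 1 to [k] enter, so it is known at time [k]; the next factor is exactly the one
    produced by [extragradient_step]. *)
Definition weight k x := \prod_(1 <= j < k.+1) (1 + 4 * amplification j x).

Definition noise k x := H (z k x) - Hn (z k x) (w k.+1 x).

Definition noise_half k x := H (zh k x) - Hn (zh k x) (w k.+1 x).

Lemma weightS k x :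
  weight k.+1 x = weight k x * (1 + 4 * amplification k.+1 x).
Proof. by rewrite /weight big_nat_recr. Qed.

Lemma weight_ge1 k x : 1 <= weight k x.
Proof.
elim: k => [|k IH]; first by rewrite /weight big_nil.
by rewrite weightS -[leLHS]mulr1 ler_pM// lerDl mulr_ge0// sqr_ge0.
Qed.

Lemma weight_gt0 k x : 0 < weight k x.
Proof. exact: lt_le_trans ltr01 (weight_ge1 k x). Qed.

Lemma weight_adapted k : measurable_fun setT (weight k : TG k -> R).
Proof.
suff : forall j, (j <= k)%N -> measurable_fun setT (weight j : TG k -> R).
  exact.
elim=> [_|j IH jk].
  rewrite (_ : weight 0 = cst 1); first exact: measurable_cst.
  by apply/funext => x; rewrite /weight big_nil.
rewrite (_ : weight j.+1 = fun x => weight j x * (1 + 4 * amplification j.+1 x)).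
  apply: measurable_funM; first by apply: IH; exact: ltnW.
  apply: measurable_funD => //; apply: measurable_funM => //.
  apply: measurable_funX; apply: measurable_funM => //.
  by apply: measurableT_comp => //; exact: sample_adapted.
by apply/funext => x; rewrite weightS.
Qed.

Lemma err_adapted k : measurable_fun setT (err k : TG k -> R).
Proof.
have mz : coord_measurable (fun x : TG k => z k x - zs).
  apply: coord_measurableB; last exact: coord_measurable_cst.
  by move=> i; apply: measurable_coord; exact: seg_adapted.
exact: measurable_dotv.
Qed.

Let mz k : coord_measurable (fun x => z k x - zs).
Proof.
apply: coord_measurableB; last exact: coord_measurable_cst.
by move=> i; apply: measurable_coord; exact: measurable_seg.
Qed.

Let mzh k : measurable_fun setT (zh k : Omega -> bvec).
Proof. by apply: measurable_half_step; exact: measurable_seg. Qed.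

Let mHz (X : Omega -> bvec) : measurable_fun setT X ->
  coord_measurable (fun x => H (X x)).
Proof.
move=> mX i.
by apply: (@continuous_measurable_rV _ _ _ _ X (fun y => H y 0 i)).
Qed.

Let mnoise k : coord_measurable (noise k).
Proof.
have mk := measurable_seg k.
by apply: coord_measurableB; [exact: mHz|exact: coord_measurable_field].
Qed.

Let err_ge0 k x : 0 <= err k x.
Proof. exact: dotvv_ge0. Qed.

Let merr k : measurable_fun setT (err k).
Proof. exact: measurable_dotv. Qed.

Lemma noise_cond_le k : cond_le P (seg_gen k)
  (fun x => dotv (noise k x) (noise k x)) (fun x => C * (1 + err k x)).
Proof.
case: A3 => _ /(_ k)[Y XY YC] _; apply: (cond_exp_le _ (Y := Y)).
- exact: seg_gen_measurable.
- by under eq_fun do rewrite -norm2_sqr.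
- by apply: measurable_funM => //; exact: measurable_funD.
- by move=> x; rewrite mulr_ge0 ?addr_ge0// ltW.
- by apply: filterS YC => x; rewrite norm2_sqr.
Qed.

Lemma noise_half_cond_le k : cond_le P (seg_gen k)
  (fun x => dotv (noise_half k x) (noise_half k x))
  (fun x => C * (1 + dotv (zh k x - zs) (zh k x - zs))).
Proof.
case: A3 => _ _ /(_ k)[Y [D [XY ZD YD]]].
apply: (cond_exp_le_cond_exp _ _ _ _ (Y := Y) (D := D)) => //.
- exact: seg_gen_measurable.
- exact: ltW.
- apply: measurable_dotv; (apply: coord_measurableB;
    last exact: coord_measurable_cst) => i; exact: measurable_coord.
- by move=> x; exact: dotvv_ge0.
- by under eq_fun do rewrite -norm2_sqr.
- by under eq_fun do rewrite -norm2_sqr.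
Qed.

(** The coefficient of [eta ^+ 2] in [extragradient_step]. *)
Definition update_sq k x :=
  L ^+ 2 * dotv (Hn (z k x) (w k.+1 x)) (Hn (z k x) (w k.+1 x)) +
  dotv (Hn (zh k x) (w k.+1 x)) (Hn (zh k x) (w k.+1 x)) +
  4 * dotv (noise k x) (noise k x).

Let update_sq_ge0 k x : 0 <= update_sq k x.
Proof.
rewrite /update_sq; have := mulr_ge0 (sqr_ge0 L)
  (dotvv_ge0 (Hn (z k x) (w k.+1 x))).
have := dotvv_ge0 (Hn (zh k x) (w k.+1 x)); have := dotvv_ge0 (noise k x).
by lra.
Qed.

Let mupdate_sq k : measurable_fun setT (update_sq k).
Proof.
have m1 := coord_measurable_field k (measurable_seg k).
have m2 := coord_measurable_field k (mzh k).
apply: measurable_funD; last first.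
  by apply: measurable_funM => //; exact: measurable_dotv.
by apply: measurable_funD; [apply: measurable_funM => //|]; exact: measurable_dotv.
Qed.

(** [a] collects the coefficients of the squared noise at [z k], both direct and through the
    half-step distance; the remaining terms are those of 1 and of [err k]. *)
Definition growth_const : R :=
  let a := 2 * L ^+ 2 + 4 + 4 * (2 * K ^+ 2 + 2 * C) in
  a * C + (2 * C + (2 * L ^+ 2 * K ^+ 2 + 3 * (2 * K ^+ 2 + 2 * C))).

Let growth_const_ge0 : 0 <= growth_const.
Proof.
have C0 := ltW C_gt0; have K2 := sqr_ge0 K; have L2 := sqr_ge0 L.
by rewrite /growth_const; nonneg.
Qed.

(** The half-step noise goes first: its variance bound involves the distance of the half step to
    [zs], which [err k] and the noise at [z k] control; that noise is then eliminated given
    [G k]. *)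
Lemma update_sq_cond_le k : cond_le P (seg_gen k) (update_sq k)
  (fun x => growth_const * (1 + err k x)).
Proof.
have C0 := ltW C_gt0; have K2 := sqr_ge0 K; have L2 := sqr_ge0 L.
set eta := step k.+1; have eta0 : 0 < eta := step_gt0 k.
have eta2 : eta ^+ 2 <= 1 by rewrite expr_le1 ?(ltW eta0)//; exact: step_le1.
have etaK : eta ^+ 2 * K ^+ 2 <= 1 / 16.
  rewrite -exprMn; have -> : 1 / 16 = (1 / 4) ^+ 2 :> R by field.
  have eK0 : 0 <= eta * K by rewrite mulr_ge0 ?(ltW eta0) ?(ltW K_gt0).
  have eK1 : eta * K <= 1 / 4 by exact: step_small.
  by rewrite lerXn2r// nnegrE.
pose x2 x := dotv (noise k x) (noise k x).
pose y2 x := dotv (noise_half k x) (noise_half k x).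
pose s x := dotv (zh k x - zs) (zh k x - zs).
have x2_ge0 x : 0 <= x2 x by exact: dotvv_ge0.
have s_ge0 x : 0 <= s x by exact: dotvv_ge0.
have y2_ge0 x : 0 <= y2 x by exact: dotvv_ge0.
have h1_le x : dotv (Hn (z k x) (w k.+1 x)) (Hn (z k x) (w k.+1 x)) <=
    2 * (K ^+ 2 * err k x) + 2 * x2 x.
  have -> : Hn (z k x) (w k.+1 x) = H (z k x) - noise k x.
    by rewrite /noise opprB addrC subrK.
  apply: le_trans (dotvD_le _ _) _; rewrite dotvNl dotvNr opprK.
  by rewrite lerD2r ler_wpM2l.
have h2_le x : dotv (Hn (zh k x) (w k.+1 x)) (Hn (zh k x) (w k.+1 x)) <=
    2 * (K ^+ 2 * s x) + 2 * y2 x.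
  have -> : Hn (zh k x) (w k.+1 x) = H (zh k x) - noise_half k x.
    by rewrite /noise_half opprB addrC subrK.
  apply: le_trans (dotvD_le _ _) _; rewrite dotvNl dotvNr opprK.
  by rewrite lerD2r ler_wpM2l.
(* From [2 * err + 2 * eta ^+ 2 * (2 * K ^+ 2 * err + 2 * x2)], with [eta ^+ 2 * K ^+ 2 <= 1 / 16]
   and [eta ^+ 2 <= 1]. *)
have s_le x : s x <= 3 * err k x + 4 * x2 x.
  have -> : s x = dotv ((z k x - zs) - eta *: Hn (z k x) (w k.+1 x))
      ((z k x - zs) - eta *: Hn (z k x) (w k.+1 x)).
    by rewrite /s /seg_half /half_step addrAC.
  apply: le_trans (dotvD_le _ _) _; rewrite dotvNl dotvNr opprK dotvZl dotvZr.
  rewrite [eta * (eta * _)]mulrA -expr2 -/(err k x).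
  have h := ler_wpM2l (sqr_ge0 eta) (h1_le x).
  have := ler_wpM2r (err_ge0 k x) etaK; have := ler_wpM2r (x2_ge0 x) eta2.
  have := err_ge0 k x.
  lra.
have mx2 : measurable_fun setT x2 by exact: measurable_dotv.
have ms : measurable_fun setT s.
  by apply: measurable_dotv; (apply: coord_measurableB;
    last exact: coord_measurable_cst) => i; exact: measurable_coord.
have my2 : measurable_fun setT y2.
  have m k' : coord_measurable (noise_half k').
    by apply: coord_measurableB; [exact: mHz|exact: coord_measurable_field].
  exact: measurable_dotv.
set a := 2 * L ^+ 2 + 4 + 4 * (2 * K ^+ 2 + 2 * C).
set b := 2 * L ^+ 2 * K ^+ 2 + 3 * (2 * K ^+ 2 + 2 * C).
have a0 : 0 <= a by rewrite /a; nonneg.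
have b0 : 0 <= b by rewrite /b; nonneg.
have step1 : cond_le P (seg_gen k) (update_sq k)
    (fun x => 2 * (C * (1 + s x)) + (L ^+ 2 * (2 * (K ^+ 2 * err k x) + 2 * x2 x) +
      2 * (K ^+ 2 * s x) + 4 * x2 x)).
  apply: (cond_le_trans_affine (@seg_gen_measurable k) (U := y2)) => //.
  - by move=> x; nonneg.
  - by move=> x; nonneg.
  - by apply: measurable_funM => //; exact: measurable_funD.
  - by repeat (apply: measurable_funD || apply: measurable_funM).
  - move=> x; rewrite /update_sq -/(x2 x).
    have := h2_le x; have := ler_wpM2l L2 (h1_le x); lra.
  - exact: noise_half_cond_le.
have step2 : cond_le P (seg_gen k)
    (fun x => 2 * (C * (1 + s x)) + (L ^+ 2 * (2 * (K ^+ 2 * err k x) + 2 * x2 x) +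
      2 * (K ^+ 2 * s x) + 4 * x2 x))
    (fun x => a * (C * (1 + err k x)) + (2 * C + b * err k x)).
  apply: (cond_le_trans_affine (@seg_gen_measurable k) (U := x2)) => //.
  - by move=> x; nonneg.
  - by move=> x; nonneg.
  - by move=> x; nonneg.
  - by repeat (apply: measurable_funD || apply: measurable_funM).
  - by repeat (apply: measurable_funD || apply: measurable_funM).
  - by repeat (apply: measurable_funD || apply: measurable_funM).
  - move=> x; have KC : 0 <= 2 * K ^+ 2 + 2 * C by nonneg.
    by have := ler_wpM2l KC (s_le x); rewrite /a /b; lra.
  - exact: noise_cond_le.
move=> A GA; have mA := gen_measurable (@seg_gen_measurable k) GA.
apply: (le_trans (step1 A GA)); apply: (le_trans (step2 A GA)).
apply: ge0_le_integral => //.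
- by move=> x _; rewrite lee_fin; nonneg.
- apply/measurable_EFinP; apply: measurable_funTS.
  by repeat (apply: measurable_funD || apply: measurable_funM).
- apply/measurable_EFinP; apply: measurable_funTS.
  by repeat (apply: measurable_funD || apply: measurable_funM).
- move=> x _; rewrite lee_fin /growth_const -/a -/b.
  by have := mulr_ge0 C0 (err_ge0 k x); lra.
Qed.

Definition scaled_err k x := (weight k x)^-1 * err k x.

Definition scaled_drift k x := (weight k x)^-1 * dotv (H (z k x)) (z k x - zs).

Let weightV_ge0 k x : 0 <= (weight k x)^-1.
Proof. by rewrite invr_ge0 ltW ?weight_gt0. Qed.

Let weightV_le1 k x : (weight k x)^-1 <= 1.
Proof. by rewrite invf_le1 ?weight_gt0 ?weight_ge1. Qed.

Let weightV_adapted k : measurable_fun setT (fun x : TG k => (weight k x)^-1).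
Proof.
rewrite (_ : (fun x => _) = fun x : TG k => weight k x `^ (-1)).
  apply: (measurableT_comp (measurable_powR _)); exact: weight_adapted.
by apply/funext => x; rewrite powRN powRr1// ltW ?weight_gt0.
Qed.

Lemma scaled_err_ge0 k x : 0 <= scaled_err k x.
Proof. exact: mulr_ge0. Qed.

Lemma scaled_drift_ge0 k x : 0 <= scaled_drift k x.
Proof. by rewrite mulr_ge0. Qed.

Lemma scaled_err_adapted k : measurable_fun setT (scaled_err k : TG k -> R).
Proof. by apply: measurable_funM => //; exact: err_adapted. Qed.

Let mscaled_err k : measurable_fun setT (scaled_err k).
Proof.
exact: (adapted_measurable (@seg_gen_measurable k) (@scaled_err_adapted k)).
Qed.

Let mweightV k : measurable_fun setT (fun x => (weight k x)^-1).
Proof.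
exact: (adapted_measurable (@seg_gen_measurable k) (@weightV_adapted k)).
Qed.

Lemma measurable_scaled_drift k : measurable_fun setT (scaled_drift k).
Proof.
apply: measurable_funM => //; apply: measurable_dotv => //.
exact/mHz/measurable_seg.
Qed.

(** Written by coordinates, each with a factor known at time [k], because the martingale hypothesis
    is stated per coordinate of the noise. *)
Let martingale_part k x :=
  \sum_(i < dt + dm) (2 * step k.+1 * (weight k x)^-1 * (z k x - zs) 0 i) *
    noise k x 0 i.

(** Passing to [weight k.+1] divides by the very factor that [extragradient_step] produces, so no
    [V (w k.+1 x)] multiplies the noise. *)
Let scaled_err_step k x :
  scaled_err k.+1 x + 2 * step k.+1 * scaled_drift k x <=
  scaled_err k x + step k.+1 ^+ 2 * ((weight k x)^-1 * update_sq k x) +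
  martingale_part k x.
Proof.
have W0 := weight_gt0 k x.
have := extragradient_step (z := z k x - zs) (h1 := Hn (z k x) (w k.+1 x))
  (h2 := Hn (zh k x) (w k.+1 x)) (H := H (z k x)) (V := V (w k.+1 x)) (L := L)
  (step_gt0 k) (V_gt0 _) K_gt0 (step_small k).
have lip : dotv (Hn (zh k x) (w k.+1 x) - Hn (z k x) (w k.+1 x))
      (Hn (zh k x) (w k.+1 x) - Hn (z k x) (w k.+1 x)) <=
    (L * V (w k.+1 x)) ^+ 2 *
    (step k.+1 ^+ 2 * dotv (Hn (z k x) (w k.+1 x)) (Hn (z k x) (w k.+1 x))).
  apply: le_trans (Hn_lipschitz _ _ _) _; rewrite ler_wpM2l ?sqr_ge0//.
  have -> : zh k x - z k x = - (step k.+1 *: Hn (z k x) (w k.+1 x)).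
    by rewrite /seg_half /half_step addrAC subrr add0r.
  by rewrite dotvNl dotvNr opprK dotvZl dotvZr mulrA -expr2.
move=> /(_ lip (H_growth _)).
have -> : z k x - zs - step k.+1 *: Hn (zh k x) (w k.+1 x) = z k.+1 x - zs.
  by rewrite /= addrAC.
rewrite -/(err k.+1 x) -/(err k x) -/(noise k x) -/(amplification k.+1 x).
set B := 1 + _; have B0 : 0 < B.
  by rewrite ltr_wpDr// mulr_ge0// sqr_ge0.
move=> h; have : scaled_err k.+1 x <= (weight k x)^-1 * (err k x -
    2 * step k.+1 * dotv (H (z k x)) (z k x - zs) +
    2 * step k.+1 * dotv (noise k x) (z k x - zs) +
    step k.+1 ^+ 2 * update_sq k x).
  rewrite /scaled_err weightS -/B invfM -[leLHS]mulrA ler_wpM2l//.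
  by rewrite ler_pdivrMl.
have -> : martingale_part k x =
    (weight k x)^-1 * (2 * step k.+1 * dotv (noise k x) (z k x - zs)).
  rewrite /martingale_part /dotv !big_distrr /=; apply: eq_bigr => i _; ring.
rewrite /scaled_err /scaled_drift; lra.
Qed.

Let integrable_nneg (A : set Omega) (f : Omega -> R) : measurable A ->
  measurable_fun setT f -> (forall x, 0 <= f x) ->
  (\int[P]_(x in A) (f x)%:E < +oo)%E -> P.-integrable A (EFin \o f).
Proof.
move=> mA mf f0 ffin; apply/integrableP; split.
  by apply/measurable_EFinP; exact: measurable_funTS.
by under eq_integral => x _ do rewrite /= ger0_norm//.
Qed.

Let integral_weighted_const k A c : G k A -> 0 <= c ->
  (\int[P]_(x in A) ((weight k x)^-1 * (c * (1 + err k x)))%:E <=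
   c%:E * (P A + \int[P]_(x in A) (scaled_err k x)%:E))%E.
Proof.
move=> GA c0; have mA := gen_measurable (@seg_gen_measurable k) GA.
apply: (@le_trans _ _ (\int[P]_(x in A) (c%:E * (1 + (scaled_err k x)%:E)))%E).
  apply: ge0_le_integral => //.
  - by move=> x _; rewrite lee_fin; nonneg.
  - apply/measurable_EFinP; apply: measurable_funTS.
    by repeat (apply: measurable_funD || apply: measurable_funM).
  - apply: measurable_funeM; apply: emeasurable_funD => //.
    by apply/measurable_EFinP; exact: measurable_funTS.
  - move=> x _; rewrite -EFinD -EFinM lee_fin mulrCA ler_wpM2l//.
    by rewrite mulrDr mulr1 lerD2r.
rewrite ge0_integralZl//; last 2 first.
- apply: emeasurable_funD => //.
  by apply/measurable_EFinP; exact: measurable_funTS.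
- by move=> x _; rewrite adde_ge0// lee_fin scaled_err_ge0.
rewrite ge0_integralD//; last 2 first.
- by move=> x _; rewrite lee_fin scaled_err_ge0.
- by apply/measurable_EFinP; exact: measurable_funTS.
by rewrite integral_cst// mul1e.
Qed.

Let integral_weighted_fin k A c : G k A -> 0 <= c ->
  (\int[P]_(x in A) (scaled_err k x)%:E < +oo ->
   \int[P]_(x in A) ((weight k x)^-1 * (c * (1 + err k x)))%:E < +oo)%E.
Proof.
move=> GA c0 ufin; have mA := gen_measurable (@seg_gen_measurable k) GA.
apply: le_lt_trans (integral_weighted_const GA c0) _.
rewrite lte_mul_pinfty ?lee_fin// lte_add_pinfty//.
by rewrite (le_lt_trans (probability_le1 P mA))// ltry.
Qed.

(** As [step k.+1 <= 1], the term is dominated by the inverse weight times [err k] plus the squared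
    noise. The inverse weight is known at time [k], so the conditional variance bound integrates
    against it. *)
Let integrable_martingale_term k A i : G k A ->
  (\int[P]_(x in A) (scaled_err k x)%:E < +oo)%E ->
  P.-integrable A (fun x => ((2 * step k.+1 * (weight k x)^-1 *
    (z k x - zs) 0 i) * noise k x 0 i)%:E).
Proof.
move=> GA ufin; have mA := gen_measurable (@seg_gen_measurable k) GA.
pose bound x := (weight k x)^-1 * (1 * (1 + err k x)) +
  (weight k x)^-1 * dotv (noise k x) (noise k x).
have mnn : measurable_fun setT (fun x => dotv (noise k x) (noise k x)).
  exact: measurable_dotv.
have i1 : P.-integrable A
    (EFin \o (fun x => (weight k x)^-1 * (1 * (1 + err k x)))).
  apply: integrable_nneg => //; last exact: integral_weighted_fin.
  - by repeat (apply: measurable_funD || apply: measurable_funM).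
  - by move=> x; nonneg.
have i2 : P.-integrable A
    (EFin \o (fun x => (weight k x)^-1 * dotv (noise k x) (noise k x))).
  apply: integrable_nneg => //.
  - exact: measurable_funM.
  - by move=> x; nonneg.
  apply: le_lt_trans (integral_weighted_fin GA (ltW C_gt0) ufin).
  apply: (le_integral_weighted (@seg_gen_measurable k)) => //.
  - by move=> x; nonneg.
  - by apply: measurable_funM => //; exact: measurable_funD.
  - by move=> x; apply: mulr_ge0; [exact: ltW|nonneg].
  - exact: noise_cond_le.
have ibound : P.-integrable A (EFin \o bound).
  exact: (eq_integrable mA _ _ _ (integrableD mA i1 i2)).
apply: (le_integrable mA _ _ ibound).
  apply/measurable_EFinP; apply: measurable_funTS.
  apply: measurable_funM; last exact: mnoise.
  by apply: measurable_funM; [exact: measurable_funM|exact: mz].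
move=> x _; rewrite /= lee_fin.
have b0 : 0 <= bound x by rewrite /bound; nonneg.
rewrite (ger0_norm b0) /bound mul1r -mulrDr.
rewrite !normrM (ger0_norm (weightV_ge0 k x)) (ger0_norm (ltW (step_gt0 k))).
rewrite (ger0_norm (ler0n R 2)).
set p := `|(z k x - zs) 0 i|; set q := `|noise k x 0 i|.
have -> : 2 * step k.+1 * (weight k x)^-1 * p * q =
    (weight k x)^-1 * (step k.+1 * (2 * (p * q))) by ring.
rewrite ler_wpM2l//.
have ei := coord_le_norm2 (z k x - zs) i.
have ni := coord_le_norm2 (noise k x) i.
have e2 := norm2_sqr (z k x - zs); have n2 := norm2_sqr (noise k x).
rewrite -/(err k x) in e2; rewrite -e2 -n2.
have pq : p * q <= norm2 (z k x - zs) * norm2 (noise k x).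
  by apply: ler_pM => //; exact: normr_ge0.
have p0 : 0 <= 2 * (p * q) by rewrite !mulr_ge0 ?normr_ge0.
have := sqr_ge0 (norm2 (z k x - zs) - norm2 (noise k x)).
have := ler_wpM2r p0 (step_le1 k); rewrite sqrrB; lra.
Qed.

Let integral_martingale_part k A : G k A ->
  (\int[P]_(x in A) (scaled_err k x)%:E < +oo)%E ->
  P.-integrable A (EFin \o martingale_part k) /\
  (\int[P]_(x in A) (martingale_part k x)%:E = 0)%E.
Proof.
move=> GA ufin; have mA := gen_measurable (@seg_gen_measurable k) GA.
have iM i := integrable_martingale_term i GA ufin.
have sumE x : (martingale_part k x)%:E = (\sum_(i < dt + dm)
    ((2 * step k.+1 * (weight k x)^-1 * (z k x - zs) 0 i) *
    noise k x 0 i)%:E)%E by rewrite sumEFin.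
split.
  apply: (eq_integrable mA _ _ _ (integrable_sum mA (index_enum _) (fun i _ => iM i))) => x _.
  exact/esym/sumE.
under eq_integral do rewrite sumE.
rewrite integral_sum// big1// => i _.
case: A3 => /(_ k i)[ixi ce0] _ _.
apply: (integral_martingale_weighted (@seg_gen_measurable k) _ ixi) => //.
- apply: measurable_funM; first exact: measurable_funM.
  by apply: (coord_measurableB _ (coord_measurable_cst _)) => j;
    apply: measurable_coord; exact: seg_adapted.
- by case: ce0 => _ ce0 B /ce0 <-; rewrite integral0.
Qed.

(** Integration of [scaled_err_step], where the martingale part vanishes. The result is [u_step]
    with [e k = growth_const * step k.+1 ^+ 2] and [c k = 2 * step k.+1]. *)
Lemma scaled_err_drift k A : G k A ->
  (\int[P]_(x in A) (scaled_err k x)%:E < +oo ->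
   \int[P]_(x in A) (scaled_err k.+1 x)%:E +
     (2 * step k.+1)%:E * \int[P]_(x in A) (scaled_drift k x)%:E <=
   (1 + growth_const * step k.+1 ^+ 2)%:E * \int[P]_(x in A) (scaled_err k x)%:E +
     (growth_const * step k.+1 ^+ 2)%:E * P A)%E.
Proof.
move=> GA ufin; have mA := gen_measurable (@seg_gen_measurable k) GA.
have [iM M0] := integral_martingale_part GA ufin.
pose Q x := step k.+1 ^+ 2 * ((weight k x)^-1 * update_sq k x).
have eta0 : 0 <= step k.+1 by exact: ltW.
have Q0 x : 0 <= Q x by rewrite /Q; nonneg.
have mQ : measurable_fun setT Q.
  by apply: measurable_funM => //; exact: measurable_funM.
have mE (f : Omega -> R) : measurable_fun setT f ->
    measurable_fun A (fun x => (f x)%:E).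
  by move=> mf; apply/measurable_EFinP; exact: measurable_funTS.
have Qle : (\int[P]_(x in A) (Q x)%:E <=
    (growth_const * step k.+1 ^+ 2)%:E *
    (P A + \int[P]_(x in A) (scaled_err k x)%:E))%E.
  under eq_integral do rewrite EFinM.
  rewrite ge0_integralZl//; last 3 first.
  - by apply: mE; exact: measurable_funM.
  - by move=> x _; rewrite lee_fin; nonneg.
  - by rewrite lee_fin sqr_ge0.
  rewrite [growth_const * _]mulrC [(_ * growth_const)%:E]EFinM -muleA.
  rewrite lee_wpmul2l ?lee_fin ?sqr_ge0//.
  apply: le_trans (integral_weighted_const GA growth_const_ge0).
  apply: (le_integral_weighted (@seg_gen_measurable k)) => //.
  - by apply: measurable_funM => //; exact: measurable_funD.
  - by move=> x; nonneg.
  - exact: update_sq_cond_le.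
have Qfin : (\int[P]_(x in A) (Q x)%:E < +oo)%E.
  apply: le_lt_trans Qle _; rewrite lte_mul_pinfty//.
    by rewrite lee_fin; nonneg.
  rewrite lte_add_pinfty//.
  by rewrite (le_lt_trans (probability_le1 P mA))// ltry.
have iQ := integrable_nneg mA mQ Q0 Qfin.
have iU := integrable_nneg mA (@mscaled_err k) (@scaled_err_ge0 k) ufin.
have mD := measurable_scaled_drift k.
apply: (@le_trans _ _ (\int[P]_(x in A)
    ((scaled_err k x)%:E + (Q x)%:E + (martingale_part k x)%:E))%E).
  rewrite -ge0_integralZl//; last 3 first.
  - exact: mE.
  - by move=> x _; rewrite lee_fin scaled_drift_ge0.
  - by rewrite lee_fin mulr_ge0.
  rewrite -ge0_integralD//; last 4 first.
  - by move=> x _; rewrite lee_fin scaled_err_ge0.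
  - exact: mE.
  - by move=> x _; rewrite -EFinM lee_fin !mulr_ge0// scaled_drift_ge0.
  - by apply: measurable_funeM; exact: mE.
  apply: ge0_le_integral => //.
  - move=> x _; rewrite -EFinM -EFinD lee_fin addr_ge0 ?scaled_err_ge0//.
    by rewrite !mulr_ge0// scaled_drift_ge0.
  - apply: emeasurable_funD; first exact: mE.
    by apply: measurable_funeM; exact: mE.
  - apply: emeasurable_funD; last exact: measurable_int iM.
    by apply: emeasurable_funD; exact: mE.
  - move=> x _; rewrite -EFinM -!EFinD lee_fin; exact: scaled_err_step.
rewrite (integralD mA (integrableD mA iU iQ) iM) M0 adde0.
rewrite (integralD mA iU iQ).
apply: (@le_trans _ _ (\int[P]_(x in A) (scaled_err k x)%:E +
  (growth_const * step k.+1 ^+ 2)%:E *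
    (P A + \int[P]_(x in A) (scaled_err k x)%:E))%E); first by rewrite leeD2l.
have u0 : (0 <= \int[P]_(x in A) (scaled_err k x)%:E)%E.
  by apply: integral_ge0 => x _; rewrite lee_fin scaled_err_ge0.
have c0 : (0 <= (growth_const * step k.+1 ^+ 2)%:E)%E.
  by rewrite lee_fin; nonneg.
rewrite EFinD ge0_muleDl// mul1e ge0_muleDr//.
by rewrite [X in (_ + X <= _)%E]addeC addeA.
Qed.

Variables (CV m r : R).
Hypothesis V_moment : forall k,
  (\int[P]_x ((V (w k.+1 x)) ^+ 2)%:E <= CV%:E)%E.
Hypothesis step_sq : cvgn (series (fun k => step k.+1 ^+ 2)).
Hypothesis step_div : ~ cvgn (series (fun k => 2 * step k.+1)).
Hypotheses (m_gt0 : 0 < m) (r_gt0 : 0 < r).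
Hypothesis H_coercive : forall y,
  m * Num.min 1 (r / norm2 (y - zs)) * norm2 (y - zs) ^+ 2 <=
  dotv (H y) (y - zs).

Let amplification_ge0 j x : 0 <= amplification j x.
Proof. exact: sqr_ge0. Qed.

Let mamplification k : measurable_fun setT (amplification k.+1).
Proof.
apply: measurable_funX; apply: measurable_funM => //.
exact: measurableT_comp.
Qed.

(** The product is at most the exponential of 4 times the sum of the amplifications. By Tonelli that
    sum has expectation at most [CV] times the sum of squared steps, so it is almost surely
    finite. *)
Lemma weight_bounded :
  P.-negligible [set x | forall M : nat, exists k, M%:R < weight k x].
Proof.
pose S x := (\sum_(0 <= k <oo) (amplification k.+1 x)%:E)%E.
have iamp k : (\int[P]_x (amplification k.+1 x)%:E <=
    (CV * step k.+1 ^+ 2)%:E)%E.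
  under eq_integral do rewrite /amplification exprMn EFinM.
  rewrite ge0_integralZl//; last 3 first.
  - apply/measurable_EFinP; apply: measurable_funX; exact: measurableT_comp.
  - by move=> x _; rewrite lee_fin sqr_ge0.
  - by rewrite lee_fin sqr_ge0.
  by rewrite mulrC [leRHS]EFinM lee_wpmul2l ?lee_fin ?sqr_ge0.
have CV0 : 0 <= CV.
  rewrite -lee_fin; apply: le_trans (V_moment 0); apply: integral_ge0 => x _.
  by rewrite lee_fin sqr_ge0.
have mS k : measurable_fun setT (fun x => (amplification k.+1 x)%:E).
  exact/measurable_EFinP.
have S0 x : (0 <= S x)%E.
  by apply: nneseries_ge0 => k _ _; rewrite lee_fin.
have iS : P.-integrable setT S.
  apply/integrableP; split.
    by apply: ge0_emeasurable_sum => // k x _ _; rewrite lee_fin.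
  under eq_integral => x _ do rewrite gee0_abs//.
  rewrite integral_nneseries//; last by move=> k x _; rewrite lee_fin.
  apply: (@le_lt_trans _ _ (\sum_(0 <= k <oo) (CV * step k.+1 ^+ 2)%:E)%E).
    apply: lee_nneseries => [k _ _|k _]; last exact: iamp.
    by apply: integral_ge0 => x _; rewrite lee_fin.
  apply: nneseries_fin; last exact: cvg_series_scale.
  by move=> k; rewrite mulr_ge0// sqr_ge0.
have /= := integrable_ae measurableT iS; apply: negligibleS => x wx.
move=> /(_ Logic.I) Sfin.
have le_exp k : weight k x <= expR (4 * \sum_(0 <= j < k) amplification j.+1 x).
  elim: k => [|k IH].
    by rewrite /weight !big_geq// mulr0 expR0.
  rewrite weightS big_nat_recr//= [4 * (_ + _)]mulrDr expRD ler_pM ?expR_ge1Dx//.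
    by rewrite ltW ?weight_gt0.
  by rewrite addr_ge0// mulr_ge0.
have [k] := wx (Num.truncn (expR (4 * fine (S x)))).+1; rewrite ltNge => /negP.
apply; apply: (le_trans (le_exp k)).
apply: (@le_trans _ _ (expR (4 * fine (S x)))); last by rewrite ltW// truncnS_gt.
rewrite ler_expR ler_wpM2l// -lee_fin fineK// -sumEFin.
by apply: nneseries_lim_ge => j _ _; rewrite lee_fin.
Qed.

(** The two bounds play different roles: [err 0 x <= N%:R] is known at time 0 and makes the start
    integrable, so it is [A0]; the bound on all weights depends on the whole trajectory, so it is
    [E]. *)
Let scaled_err_cvg0 (N M : nat) : P.-negligible
  [set x | [/\ err 0 x <= N%:R, forall k, weight k x <= M%:R &
    ~ (scaled_err k x @[k --> \oo] --> (0 : R))]].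
Proof.
pose A0 := [set x | err 0 x <= N%:R].
have GA0 : G 0 A0.
  have -> : A0 = [set: TG 0] `&` err 0 @^-1` `]-oo, N%:R]%classic.
    by rewrite setTI; apply/seteqP; split=> x; rewrite /A0/= in_itv.
  by have := @err_adapted 0 measurableT _ (measurable_itv `]-oo, (N%:R : R)]).
have mA0 := gen_measurable (@seg_gen_measurable 0) GA0.
apply: (@almost_supermartingale_cvg0 _ _ _ P seg_gen _ _ scaled_err
  scaled_drift (fun k => growth_const * step k.+1 ^+ 2)
  (fun k => 2 * step k.+1) A0 _ _ _ _ _ _ _ _ _ _ _
  [set x | forall k, weight k x <= M%:R]) => //.
- exact: seg_gen_measurable.
- exact: seg_gen_mono.
- exact: scaled_err_ge0.
- exact: scaled_drift_ge0.
- exact: scaled_err_adapted.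
- exact: measurable_scaled_drift.
- by move=> k; rewrite mulr_ge0// sqr_ge0.
- by move=> k; rewrite mulr_ge0// ltW.
- exact: cvg_series_scale.
- apply: (@le_lt_trans _ _ (\int[P]_(x in A0) (N%:R)%:E)%E).
    apply: ge0_le_integral => //.
    + by move=> x _; rewrite lee_fin scaled_err_ge0.
    + by apply/measurable_EFinP; exact: measurable_funTS.
    + move=> x A0x; rewrite lee_fin; apply: le_trans A0x.
      by rewrite -[leRHS]mul1r ler_wpM2r.
  rewrite integral_cst// lte_mul_pinfty ?lee_fin//.
  by rewrite (le_lt_trans (probability_le1 P mA0))// ltry.
- by move=> k A GA _; exact: scaled_err_drift.
move=> delta delta0.
(* A scaled error above [delta] forces [err k x > delta], where coercivity gives the minimum; the
   weight costs the factor in front, with [M.+1] to cover [M = 0]. *)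
exists (M.+1%:R^-1 * (m * Num.min delta (r * Num.sqrt delta))).
  by rewrite !mulr_gt0 ?invr_gt0// lt_min delta0 mulr_gt0 ?sqrtr_gt0.
move=> k x wM du; rewrite /scaled_drift; apply: ler_pM.
- by rewrite invr_ge0.
- by rewrite mulr_ge0 ?(ltW m_gt0)// le_min (ltW delta0) mulr_ge0 ?sqrtr_ge0 ?(ltW r_gt0).
- rewrite lef_pV2 ?posrE ?weight_gt0//; apply: le_trans (wM k) _.
  by rewrite ler_nat.
apply: le_trans (H_coercive _); rewrite -mulrA ler_wpM2l ?(ltW m_gt0)//.
set rho := norm2 _.
have rho2 : delta < rho ^+ 2.
  apply: lt_le_trans du _; rewrite /rho norm2_sqr -[leRHS]mul1r.
  by rewrite ler_wpM2r.
have rho0 : 0 < rho.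
  rewrite lt_neqAle norm2_ge0 andbT eq_sym; apply/eqP => rho0.
  by move: rho2; rewrite rho0 expr0n/= ltNge (ltW delta0).
have sqrho : Num.sqrt delta <= rho.
  by rewrite -[leRHS]ger0_norm ?(ltW rho0)// -sqrtr_sqr ler_wsqrtr// ltW.
have [_|_] := leP 1 (r / rho).
  by rewrite mul1r ge_min (ltW rho2).
have -> : r / rho * rho ^+ 2 = r * rho by field; rewrite gt_eqF.
by rewrite ge_min ler_wpM2l ?orbT// ltW.
Qed.

Lemma seg_cvg : {ae P, forall x, z k x @[k --> \oo] --> zs}.
Proof.
have bad : P.-negligible (\bigcup_N \bigcup_M
  [set x | [/\ err 0 x <= N%:R, forall k, weight k x <= M%:R &
    ~ (scaled_err k x @[k --> \oo] --> (0 : R))]]).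
  apply: negligible_bigcup => N; apply: negligible_bigcup => M.
  exact: scaled_err_cvg0.
apply: negligibleS (negligibleU bad weight_bounded) => x /= zx.
have [wx|wx] := pselect (forall M : nat, exists k, M%:R < weight k x).
  by right.
have [M wM] : exists M : nat, forall k, weight k x <= M%:R.
  apply: contrapT => noM; apply: wx => M; apply: contrapT => nok; apply: noM.
  by exists M => k; rewrite leNgt; apply/negP => Mk; apply: nok; exists k.
left; exists (Num.truncn (err 0 x)).+1 => //; exists M => //; split => //.
  by rewrite ltW// truncnS_gt.
move=> u0; apply: zx; apply/cvgrPdist_le => e e0.
(* The weight is at most [M], so a scaled error below this threshold gives [err k x <= e ^+ 2]. *)
have : 0 < e ^+ 2 / M.+1%:R by rewrite divr_gt0// exprn_gt0.
move: u0 => /cvgrPdist_le/[apply]; apply: filterS => k.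
rewrite sub0r normrN ger0_norm ?scaled_err_ge0// ler_pdivlMr// => se.
rewrite distrC; apply: le_trans (mx_norm_le_norm2 _) _.
rewrite -(ler_pXn2r (n := 2)) ?nnegrE ?norm2_ge0 ?(ltW e0)// norm2_sqr.
apply: le_trans se; rewrite -/(err k x) /scaled_err mulrC mulrA.
rewrite -[leLHS]mul1r ler_wpM2r// ler_pdivlMr ?weight_gt0// mul1r.
by apply: le_trans (wM k) _; rewrite ler_nat.
Qed.

End ExtraGradient.

(** * Moments of the Lipschitz factor under the law of the sample *)

Section SampleMoments.
Context {R : realType} {dt dm : nat}.
Local Notation bvec := (borel_rV R (dt + dm)).
Variables (rho : probability bvec R) (V : bvec -> R) (alpha0 CV : R).
Hypotheses (V_measurable : measurable_fun setT V) (V_ge1 : forall u, 1 <= V u).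
Hypothesis alpha0_gt2 : 2 < alpha0.
Hypothesis V_moment : (\int[rho]_u ((V u) `^ alpha0)%:E <= CV%:E)%E.

(** Since [V u >= 1] and [alpha0 > 2], the square is pointwise below the power [alpha0]. *)
Lemma second_moment_le : (\int[rho]_u ((V u) ^+ 2)%:E <= CV%:E)%E.
Proof.
apply: le_trans V_moment; apply: ge0_le_integral => //.
- by move=> u _; rewrite lee_fin sqr_ge0.
- by apply/measurable_EFinP; exact: measurable_funX.
- apply/measurable_EFinP.
  exact: (measurableT_comp (measurable_powR alpha0) V_measurable).
- move=> u _; rewrite lee_fin -powR_mulrn ?(le_trans ler01)//.
  by rewrite ler_powR// ltW.
Qed.

Lemma sample_integrable : rho.-integrable setT (EFin \o V).
Proof.
apply/integrableP; split; first exact/measurable_EFinP.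
apply: (@le_lt_trans _ _ CV%:E); last exact: ltry.
apply: le_trans second_moment_le; apply: ge0_le_integral => //.
- apply: measurableT_comp => //.
  exact/measurable_EFinP.
- by apply/measurable_EFinP; exact: measurable_funX.
- move=> u _; have V1 := V_ge1 u; have V0 := le_trans ler01 V1.
  by rewrite /= lee_fin ger0_norm// expr2 ler_peMl.
Qed.

Lemma sample_second_moment d (Omega : measurableType d) (P : probability Omega R)
    (X : Omega -> bvec) : measurable_fun setT X ->
  (forall B : set bvec, measurable B -> P (X @^-1` B) = rho B) ->
  (\int[P]_x ((V (X x)) ^+ 2)%:E <= CV%:E)%E.
Proof.
move=> mX lawX; apply: le_trans second_moment_le.
have := @ge0_integral_pushforward _ _ _ _ R X mX P setT
  (fun u => ((V u) ^+ 2)%:E) measurableT.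
rewrite preimage_setT => <-; last 2 first.
- by apply/measurable_EFinP; exact: measurable_funX.
- by move=> u _; rewrite lee_fin sqr_ge0.
rewrite (eq_measure_integral rho)// => A mA _; exact: lawX.
Qed.

End SampleMoments.

(** * Assembly: the constants of the abstract convergence result *)

Theorem theorem5p1 (R : realType) (dt dm : nat)
  (rho : probability (borel_rV R (dt + dm)) R)
  (F : 'rV[R]_(dt + dm) -> borel_rV R (dt + dm) -> R)
  (F_integrable : forall z, rho.-integrable setT (fun w => (F z w)%:E))
  (F_differentiable : forall w z, differentiable (fun y => F y w) z)
  (f : 'rV[R]_(dt + dm) -> R)
  (f_def : forall z, f z = \int[rho]_w F z w)
  (zs : 'rV[R]_(dt + dm)) (zs_saddle : saddle_point f zs)
  (H := saddle_field f)
  (Hn := fun z w => saddle_field (fun y => F y w) z)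
  (xi := fun z w => H z - Hn z w)
  (hA1 : assumptionA1 f zs)
  (hA2 : assumptionA2 rho Hn)
  (d : measure_display) (Omega : measurableType d) (P : probability Omega R)
  (z0 : Omega -> borel_rV R (dt + dm)) (z0_measurable : measurable_fun setT z0)
  (w : nat -> Omega -> borel_rV R (dt + dm))
  (w_measurable : forall k, measurable_fun setT (w k.+1))
  (w_law : forall k (B : set (borel_rV R (dt + dm))), measurable B ->
    P (w k.+1 @^-1` B) = rho B)
  (C : R) (C_gt0 : 0 < C) (a : R) (a_bounds : 1 / 2 < a < 1) :
  exists2 eta0 : R, 0 < eta0 &
  forall eta : R, 0 < eta <= eta0 ->
    let step := poly_step eta a in
    let z := seg Hn step z0 w in
    let zh := seg_half Hn step z0 w in
    let zbar := seg_avg Hn step z0 w in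
    let G := seg_filtration Hn step z0 w in
    assumptionA3 P xi zs G z zh w C ->
    {ae P, forall x, z k x @[k --> \oo] --> zs} /\
    {ae P, forall x, zbar k x @[k --> \oo] --> zs}.
Proof.
have [V [alpha0 [CV [LG [[mV V1] alpha2 [CV0 LG0] Vmom Hlip]]]]] := hA2.
have [[df dgrad] fcc _ [Z [Zzs [[C1 C10 HC1] [m m0 Hm]]]]] := hA1.
have iV := sample_integrable mV V1 alpha2 Vmom.
set EV := \int[rho]_u V u.
have EV0 : 0 <= EV by apply: Rintegral_ge0 => u _; exact: le_trans (V1 u).
(* At [z = zs] the linear and quadratic terms of the local expansion vanish, so the expansion itself
   forces the zero. *)
have Hzs : H zs = 0.
  have := HC1 zs (nbhs_singleton Zzs).
  rewrite subrr mul0mx subr0 -/H.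
  rewrite [norm2 (0 : 'rV_(dt + dm))]/norm2 dotvr0 sqrtr0 expr0n mulr0 => H0.
  apply/rowP => i; rewrite [RHS]mxE; apply/eqP; rewrite -normr_eq0 eq_le normr_ge0.
  by rewrite andbT; exact: le_trans (coord_le_norm2 _ _) H0.
have Hlip_mean z1 z2 i : `|(H z1 - H z2) 0 i| <= LG * norm2 (z1 - z2) * EV.
  rewrite saddle_field_diff_coord; apply: (@grad_integral_lipschitz _ _ _ rho _ F) => //.
  move=> u s; rewrite -(saddle_field_diff_coord (F^~ u) (F^~ u)).
  apply: le_trans (coord_le_norm2 _ _) _; apply: le_trans (Hlip _ _ _) _.
  by rewrite opprD addrACA subrr add0r.
(* The added 1 gives [K <= K ^+ 2], so [K ^+ 2] dominates the squared Lipschitz constant without a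
   square root. *)
pose K := (dt + dm)%:R * (LG * EV) ^+ 2 + 1.
have K1 : 1 <= K by rewrite /K lerDr mulr_ge0// sqr_ge0.
have K0 : 0 < K by exact: lt_le_trans K1.
have Hgrowth z : dotv (H z) (H z) <= K ^+ 2 * dotv (z - zs) (z - zs).
  rewrite -[H z]subr0 -Hzs.
  have c0 : 0 <= LG * norm2 (z - zs) * EV.
    by rewrite !mulr_ge0 ?norm2_ge0// ltW.
  apply: le_trans (dotv_le_mx_norm c0 (Hlip_mean z zs)) _.
  have -> : (LG * norm2 (z - zs) * EV) ^+ 2 =
      (LG * EV) ^+ 2 * dotv (z - zs) (z - zs) by rewrite -norm2_sqr; ring.
  rewrite mulrA ler_wpM2r ?dotvv_ge0//.
  apply: (@le_trans _ _ K); first by rewrite /K lerDl.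
  by rewrite expr2 ler_peMl// ltW.
have [r r0 Hr] : exists2 r, 0 < r & forall y, norm2 (y - zs) <= r -> Z y.
  have /nbhs_ballP[e /= e0 eZ] := Zzs; exists (e / 2); first by rewrite divr_gt0.
  move=> y ye; apply: eZ; rewrite mx_norm_ball /ball_/= distrC.
  apply: le_lt_trans (mx_norm_le_norm2 _) _; apply: le_lt_trans ye _.
  by rewrite gtr_pMr// invf_lt1// ltr1n.
have Hcoercive := saddle_field_growth fcc df r0 m0 (fun y yr => Hm y (Hr y yr)).
(* Every step is at most [eta]: the bound 1 yields [step_le1], and [1 / (4 * K)] yields
   [step_small], from which the factor 4 of the weights was obtained. *)
exists (Num.min 1 (1 / (4 * K))); first by rewrite lt_min ltr01 divr_gt0// mulr_gt0.
move=> eta /andP[eta_gt0]; rewrite le_min => /andP[eta1 etaK] step z zh zbar G A3.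
have a0 : 0 <= a by case/andP: a_bounds => a2 _; apply: le_trans (ltW a2).
have step_gt0 k : 0 < step k.+1 by exact: poly_step_gt0.
have step_le k : step k.+1 <= eta by exact: poly_step_le.
have [step_div step_sq] := poly_step_series eta_gt0 a_bounds.
have V_gt0 u : 0 < V u by exact: lt_le_trans (V1 u).
have cvg_z : {ae P, forall x, z k x @[k --> \oo] --> zs}.
  apply: (@seg_cvg R dt dm _ Omega P H Hn zs V LG K C step z0 w
    _ _ _ _ _ _ _ _ _ _ _ _ _ _ _ _ CV m r) => //.
  - move=> i x; rewrite (_ : (fun y => _) = (fun y => if (i < dt)%N
      then grad f y 0 i else - grad f y 0 i)); last first.
      by apply/funext => y; rewrite -saddle_field_coord.
    have cg : (fun y => grad f y 0 i) y @[y --> x] --> grad f x 0 i.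
      have cgx := differentiable_continuous (dgrad x).
      have cco := @coord_continuous R 1 (dt + dm) 0 i (grad f x).
      exact: (cvg_comp _ _ cgx cco).
    case: (i < dt)%N => //; exact: (cvgN cg).
  - move=> y; apply: le_trans (Hcoercive y).
    apply: mulr_ge0; last exact: sqr_ge0.
    apply: mulr_ge0; first exact: ltW.
    rewrite le_min ler01/=.
    by rewrite divr_ge0 ?norm2_ge0// ltW.
  - move=> y i; rewrite (_ : (fun u => _) = (fun u => if (i < dt)%N
      then grad (F^~ u) y 0 i else - grad (F^~ u) y 0 i)); last first.
      by apply/funext => u; rewrite -saddle_field_coord.
    have mg : measurable_fun setT (fun u : borel_rV R (dt + dm) => grad (F^~ u) y 0 i).
      apply: measurable_grad => // y'; apply/measurable_EFinP.
      exact: measurable_int (F_integrable y').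
    case: (i < dt)%N => //; exact: measurable_funN.
  - move=> u i; apply: (lipschitz_coord_continuous (c := LG * V u)) => x y.
    by apply: le_trans (Hlip _ _ _) _; rewrite mulrAC.
  - move=> u z1 z2; rewrite -!norm2_sqr -exprMn lerXn2r ?nnegrE ?norm2_ge0//.
      by rewrite !mulr_ge0 ?norm2_ge0// ltW.
    by apply: le_trans (Hlip _ _ _) _; rewrite mulrAC.
  - by move=> k; exact: le_trans (step_le k) eta1.
  - move=> k; apply: (@le_trans _ _ (eta * K)); first by rewrite ler_wpM2r// ltW.
    move: etaK; rewrite ler_pdivlMr ?mulr_gt0//; lra.
  - by move=> k; apply: (sample_second_moment mV _ alpha2 Vmom) => //;
      exact: w_law.
split=> //; apply: filterS cvg_z => x; exact: cvg_average.
Qed.
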